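(* Let $h(z)=\sum_{j=0}^\infty h_jz^j$ be a fixed function analytic in the unit disc $D$ with $0<|h_j|\le M$ for all $j$. Let $f(z)=\sum_{j=0}^\infty f_jz^j$ be such that $F(z):=\sum_{j=0}^\infty\frac{f_j}{h_j}z^j$ is bounded and analytic in $D$. Then there exists an integer $n_1$ such that for every $n\ge n_1$, with $N=2n+1$, there exist pairwise distinct numbers $\lambda_1,\dots,\lambda_N$ with $|\lambda_k|=1$ such that \[|H_N(\lambda;z)-f(z)|\le|z|^n\frac{(5-|z|)^{n+1}}{4^{n-1}}\cdot\frac{2M}{3}\cdot\frac{3+|z|}{(1-|z|)^4},\qquad |z|<1,\] where $H_N(\lambda;z)=\sum_{k=1}^N\lambda_kh(\lambda_kz)$.
   Context: In the paper the threshold is written $n\ge n_1(-F)$, where $n_1(g)$ denotes an integer (depending on $g$) for which the following holds for all $n\ge n_1(g)$: writing $g=\sum(-a_j)z^j$, the roots of $P_n(g;z):=s_n(z)+z^{2n+1}\overline{s}_n(1/z)$ ($s_n$ the $n$-th Taylor polynomial of $\exp\int_0^z g$, $\overline{s}_n$ its coefficient-conjugate) are simple, lie on $|z|=1$, and their reciprocals $\lambda_k$ satisfy $\sum_k\lambda_k^{j+1}=a_j$ for $j<n$ and $|\sum_k\lambda_k^{j+1}-a_j|<r^{n+1}(r-\varepsilon)^{-j}/(2\varepsilon(1-r))$ for $j\ge n$, $0<\varepsilon<r<1$. *)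

(* Defs.v *)
From Stdlib Require Import Reals ZArith.
From Coquelicot Require Export Coquelicot.
Open Scope R_scope.

(* Sum of the complex power series sum_j a_j z^j (Coquelicot's total Series,
   applied to real and imaginary parts; equals the true sum when the series
   converges). *)
Definition psum (a : nat -> C) (z : C) : C :=
  (Series (fun j => Re (Cmult (a j) (Cpow z j))),
   Series (fun j => Im (Cmult (a j) (Cpow z j)))).

Fixpoint Csum (a : nat -> C) (n : nat) : C :=
  match n with
  | O => RtoC 0
  | S m => Cplus (Csum a m) (a m)
  end.

Definition H_N (h : nat -> C) (N : nat) (lam : nat -> C) (z : C) : C :=
  Csum (fun k => Cmult (lam k) (psum h (Cmult (lam k) z))) N.

Definition err_bound (M : R) (n : nat) (r : R) : R :=
  r ^ n * (5 - r) ^ (S n) / powerRZ 4 (Z.of_nat n - 1)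
  * (2 * M / 3) * ((3 + r) / (1 - r) ^ 4).

(* Main.v *)
(* Put [a_j = f_j / h_j]. Since [h_j <> 0], the coefficients of [H_N - f] are
   [h_j (sum_k lam_k^(j+1) - a_j)], so it suffices to find distinct unimodular [lam_k] with
   [sum_k lam_k^(j+1) = a_j] for [j < n]: the tail is then estimated by the trivial bound
   [|sum_k lam_k^(j+1) - a_j| <= 2 n + 1 + O(1)], which the stated bound absorbs for large [n].
   Let [s_n] be the Taylor polynomial of [E = exp (- int_0^z F)]. By Parseval and AM-GM
   [sum |a_j| / (j+1)] is finite, hence so is the sum of the moduli of the coefficients of [E],
   and [s_n exp (- G_n)], with [G_n] the Taylor polynomial of [- int_0^z F], has positive real
   part on the unit circle for large [n]. This gives a continuous argument of [s_n (e^(i t))]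
   with no winding, so [arg s_n - (n + 1/2) t] decreases by [(2 n + 1) pi] over a period, and the
   intermediate value theorem yields [2 n + 1] unimodular zeros of
   [s_n (z) + om z^(2n+1) conj s_n (1/z)] for a unimodular [om]. Newton's identities for their
   reciprocals [lam_k], compared with [E' = - F E], give the power sums. *)

Require Import Defs.
From Stdlib Require Import Reals ZArith.
From Coquelicot Require Import Coquelicot.
From Stdlib Require Import Lra Lia Psatz.
Open Scope R_scope.

(** * Finite sums and a discrete Parseval identity *)

Fixpoint Rsum (a : nat -> R) (n : nat) : R :=
  match n with
  | O => 0
  | S m => Rsum a m + a m
  end.

Lemma Rsum_ext (a b : nat -> R) (n : nat) :
  (forall j, (j < n)%nat -> a j = b j) -> Rsum a n = Rsum b n.
Proof.
  induction n as [|n IH]; intros H; simpl; [reflexivity|].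
  rewrite IH, H by auto with arith; reflexivity.
Qed.

Lemma Rsum_plus (a b : nat -> R) (n : nat) :
  Rsum (fun j => a j + b j) n = Rsum a n + Rsum b n.
Proof. induction n as [|n IH]; simpl; [|rewrite IH]; ring. Qed.

Lemma Rsum_scal (c : R) (a : nat -> R) (n : nat) :
  Rsum (fun j => c * a j) n = c * Rsum a n.
Proof. induction n as [|n IH]; simpl; [|rewrite IH]; ring. Qed.

Lemma Rsum_const (c : R) (n : nat) : Rsum (fun _ => c) n = INR n * c.
Proof. induction n as [|n IH]; [simpl; ring|]. rewrite S_INR; simpl; rewrite IH; ring. Qed.

Lemma Rsum_le (a b : nat -> R) (n : nat) :
  (forall j, (j < n)%nat -> a j <= b j) -> Rsum a n <= Rsum b n.
Proof.
  induction n as [|n IH]; intros H; simpl; [lra|].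
  apply Rplus_le_compat; auto with arith.
Qed.

Lemma Rsum_nonneg (a : nat -> R) (n : nat) :
  (forall j, (j < n)%nat -> 0 <= a j) -> 0 <= Rsum a n.
Proof.
  intros H. apply Rle_trans with (Rsum (fun _ => 0) n).
  - rewrite Rsum_const; lra.
  - now apply Rsum_le.
Qed.

Lemma Rsum_split (a : nat -> R) (m n : nat) :
  Rsum a (m + n) = Rsum a m + Rsum (fun j => a (m + j)%nat) n.
Proof.
  induction n as [|n IH]; simpl.
  - rewrite Nat.add_0_r; ring.
  - rewrite Nat.add_succ_r; simpl; rewrite IH; ring.
Qed.

Lemma Rsum_mono (a : nat -> R) (m n : nat) :
  (forall j, 0 <= a j) -> (m <= n)%nat -> Rsum a m <= Rsum a n.
Proof.
  intros H Hmn. replace n with (m + (n - m))%nat by lia.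
  rewrite Rsum_split.
  assert (0 <= Rsum (fun j => a (m + j)%nat) (n - m)) by (apply Rsum_nonneg; auto).
  lra.
Qed.

Lemma Rsum_term_le (a : nat -> R) (j n : nat) :
  (forall i, 0 <= a i) -> (j < n)%nat -> a j <= Rsum a n.
Proof.
  intros H Hj. apply Rle_trans with (Rsum a (S j)).
  - simpl. assert (0 <= Rsum a j) by (apply Rsum_nonneg; auto). lra.
  - now apply Rsum_mono.
Qed.

(** Both sides run over the triangle [i + j < n], by antidiagonals on the left and by rows on the
    right. It turns coefficients of Cauchy products into products of truncated sums. *)
Lemma Rsum_triangle (phi : nat -> nat -> R) (n : nat) :
  Rsum (fun m => Rsum (fun i => phi i (m - i)%nat) (S m)) n
  = Rsum (fun i => Rsum (fun j => phi i j) (n - i)) n.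
Proof.
  induction n as [|n IH]; [reflexivity|].
  change (Rsum (fun m => Rsum (fun i => phi i (m - i)%nat) (S m)) n
    + Rsum (fun i => phi i (n - i)%nat) (S n)
    = Rsum (fun i => Rsum (fun j => phi i j) (S n - i)) (S n)).
  rewrite IH.
  rewrite (Rsum_ext (fun i => Rsum (fun j => phi i j) (S n - i))
     (fun i => Rsum (fun j => phi i j) (n - i) + phi i (n - i)%nat)).
  - rewrite Rsum_plus. f_equal. simpl. rewrite Nat.sub_diag; simpl; ring.
  - intros i Hi. replace (S n - i)%nat with (S (n - i)) by lia. reflexivity.
Qed.

(** * Finite complex sums *)

Lemma Re_Csum (a : nat -> C) (n : nat) : Re (Csum a n) = Rsum (fun j => Re (a j)) n.
Proof. induction n as [|n IH]; simpl; [|rewrite <- IH]; reflexivity. Qed.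

Lemma Im_Csum (a : nat -> C) (n : nat) : Im (Csum a n) = Rsum (fun j => Im (a j)) n.
Proof. induction n as [|n IH]; simpl; [|rewrite <- IH]; reflexivity. Qed.

Lemma C_eq (z w : C) : Re z = Re w -> Im z = Im w -> z = w.
Proof. destruct z, w; simpl; intros -> ->; reflexivity. Qed.

Lemma Csum_ext (a b : nat -> C) (n : nat) :
  (forall j, (j < n)%nat -> a j = b j) -> Csum a n = Csum b n.
Proof.
  induction n as [|n IH]; intros H; simpl; [reflexivity|].
  rewrite IH, H by auto with arith; reflexivity.
Qed.

Lemma Csum_plus (a b : nat -> C) (n : nat) :
  Csum (fun j => (a j + b j)%C) n = (Csum a n + Csum b n)%C.
Proof. induction n as [|n IH]; simpl; [|rewrite IH]; ring. Qed.

Lemma Csum_scal (c : C) (a : nat -> C) (n : nat) :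
  Csum (fun j => (c * a j)%C) n = (c * Csum a n)%C.
Proof. induction n as [|n IH]; simpl; [|rewrite IH]; ring. Qed.

Lemma Csum_zero (n : nat) : Csum (fun _ => RtoC 0) n = 0.
Proof. induction n as [|n IH]; simpl; [|rewrite IH]; try ring. Qed.

Lemma Csum_conj (a : nat -> C) (n : nat) :
  Cconj (Csum a n) = Csum (fun j => Cconj (a j)) n.
Proof.
  induction n as [|n IH]; simpl.
  - apply C_eq; simpl; ring.
  - rewrite Cplus_conj, IH; reflexivity.
Qed.

Lemma Csum_split (a : nat -> C) (m n : nat) :
  Csum a (m + n) = (Csum a m + Csum (fun j => a (m + j)%nat) n)%C.
Proof.
  induction n as [|n IH]; simpl.
  - rewrite Nat.add_0_r; ring.
  - rewrite Nat.add_succ_r; simpl; rewrite IH; ring.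
Qed.

Lemma Csum_S_l (a : nat -> C) (n : nat) :
  Csum a (S n) = (a O + Csum (fun j => a (S j)) n)%C.
Proof.
  change (S n) with (1 + n)%nat. rewrite Csum_split. simpl. f_equal. ring.
Qed.

Lemma Csum_rev (a : nat -> C) (n : nat) :
  Csum (fun j => a (n - 1 - j)%nat) n = Csum a n.
Proof.
  induction n as [|n IH]; [reflexivity|].
  rewrite Csum_S_l.
  rewrite (Csum_ext _ (fun j => a (n - 1 - j)%nat)) by (intros; f_equal; lia).
  rewrite IH. simpl. rewrite !Nat.sub_0_r. ring.
Qed.

Lemma Csum_swap (a : nat -> nat -> C) (m n : nat) :
  Csum (fun i => Csum (fun j => a i j) n) m = Csum (fun j => Csum (fun i => a i j) m) n.
Proof.
  induction m as [|m IH]; simpl.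
  - rewrite Csum_zero; reflexivity.
  - rewrite IH, <- Csum_plus. reflexivity.
Qed.

Lemma Cmod_Csum_le (a : nat -> C) (n : nat) :
  Cmod (Csum a n) <= Rsum (fun j => Cmod (a j)) n.
Proof.
  induction n as [|n IH]; simpl.
  - rewrite Cmod_0; lra.
  - eapply Rle_trans; [apply Cmod_triangle|]. lra.
Qed.

Lemma Csum_triangle (phi : nat -> nat -> C) (n : nat) :
  Csum (fun m => Csum (fun i => phi i (m - i)%nat) (S m)) n
  = Csum (fun i => Csum (fun j => phi i j) (n - i)) n.
Proof.
  apply C_eq.
  - rewrite !Re_Csum.
    rewrite (Rsum_ext _ (fun m => Rsum (fun i => Re (phi i (m - i)%nat)) (S m)))
      by (intros; apply Re_Csum).
    rewrite (Rsum_triangle (fun i j => Re (phi i j))).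
    apply Rsum_ext; intros; symmetry; apply Re_Csum.
  - rewrite !Im_Csum.
    rewrite (Rsum_ext _ (fun m => Rsum (fun i => Im (phi i (m - i)%nat)) (S m)))
      by (intros; apply Im_Csum).
    rewrite (Rsum_triangle (fun i j => Im (phi i j))).
    apply Rsum_ext; intros; symmetry; apply Im_Csum.
Qed.

Lemma Cmod_sqr_plus (u v : C) :
  Cmod (u + v) ^ 2 = Cmod u ^ 2 + Cmod v ^ 2 + 2 * Re (Cconj v * u).
Proof. rewrite !Cmod2_alt. destruct u, v; simpl; ring. Qed.

(** * The unit circle and orthogonality of roots of unity *)

Definition expi (t : R) : C := (cos t, sin t).

Lemma expi_plus (s t : R) : (expi s * expi t)%C = expi (s + t).
Proof. unfold expi. apply C_eq; simpl; rewrite ?cos_plus, ?sin_plus; ring. Qed.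

Lemma expi_0 : expi 0 = 1.
Proof. unfold expi. rewrite cos_0, sin_0. reflexivity. Qed.

Lemma expi_pow (t : R) (n : nat) : (expi t ^ n)%C = expi (INR n * t).
Proof.
  induction n as [|n IH].
  - simpl. rewrite Rmult_0_l. symmetry; apply expi_0.
  - rewrite Cpow_S, IH, expi_plus, S_INR. f_equal. ring.
Qed.

Lemma expi_2PI : expi (2 * PI) = 1.
Proof. unfold expi. rewrite cos_2PI, sin_2PI. reflexivity. Qed.

Lemma Cconj_expi (t : R) : Cconj (expi t) = expi (- t).
Proof. unfold expi, Cconj; simpl. rewrite cos_neg, sin_neg. reflexivity. Qed.

Lemma Cmod_expi (t : R) : Cmod (expi t) = 1.
Proof.
  unfold Cmod, expi; simpl fst; simpl snd.
  replace (cos t ^ 2 + sin t ^ 2) with 1; [apply sqrt_1|].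
  pose proof (sin2_cos2 t) as H; unfold Rsqr in H; lra.
Qed.

Lemma expi_neq_1 (t : R) : 0 < t < 2 * PI -> expi t <> 1.
Proof.
  intros Ht H. apply (f_equal Re) in H. simpl in H.
  assert (Hs : 0 < sin (t / 2)) by (apply sin_gt_0; lra).
  replace t with (2 * (t / 2)) in H by field.
  rewrite cos_2a_sin in H. nra.
Qed.

Lemma expi_inj (s t : R) : 0 < s < 2 * PI -> 0 < t < 2 * PI -> expi s = expi t -> s = t.
Proof.
  assert (W : forall s t, 0 < s -> t < 2 * PI -> s < t -> expi s = expi t -> False).
  { intros s' t' H1 H2 H3 E. apply (expi_neq_1 (t' - s')); [lra|].
    unfold Rminus. rewrite <- expi_plus, <- E, expi_plus, Rplus_opp_r. apply expi_0. }
  intros Hs Ht E. destruct (Rtotal_order s t) as [H|[H|H]]; auto; exfalso.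
  - apply (W s t); tauto.
  - apply (W t s); auto; lra.
Qed.

Lemma Csum_geom (q : C) (n : nat) : ((q - 1) * Csum (fun k => q ^ k) n = q ^ n - 1)%C.
Proof.
  induction n as [|n IH]; simpl.
  - ring.
  - rewrite Cmult_plus_distr_l, IH. ring.
Qed.

(** A geometric sum whose ratio [q] satisfies [q ^ N = 1] but [q <> 1], the latter because
    [0 < d < N]. *)
Lemma root_of_unity_sum (N d : nat) : (0 < d < N)%nat ->
  Csum (fun k => expi (2 * PI / INR N) ^ (k * d))%C N = 0.
Proof.
  intros Hd. set (q := (expi (2 * PI / INR N) ^ d)%C).
  assert (HN : 0 < INR N) by (apply lt_0_INR; lia).
  rewrite (Csum_ext _ (fun k => q ^ k)%C)
    by (intros; unfold q; rewrite <- Cpow_mult_r; f_equal; lia).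
  assert (Hq : q <> 1).
  { unfold q. rewrite expi_pow. apply expi_neq_1.
    assert (0 < INR d < INR N) by (split; [apply lt_0_INR|apply lt_INR]; lia).
    pose proof PI_RGT_0.
    replace (INR d * (2 * PI / INR N)) with (2 * PI * (INR d / INR N)) by (field; lra).
    assert (0 < INR d / INR N) by (apply Rdiv_lt_0_compat; lra).
    assert (INR d / INR N < 1) by (apply Rlt_div_l; lra). nra. }
  assert (HqN : (q ^ N)%C = 1).
  { unfold q. rewrite <- Cpow_mult_r, Nat.mul_comm, Cpow_mult_r, expi_pow.
    replace (INR N * (2 * PI / INR N)) with (2 * PI) by (field; lra).
    rewrite expi_2PI. apply Cpow_1_l. }
  assert (E := Csum_geom q N). rewrite HqN in E.
  assert (Hq1 : (q - 1)%C <> 0).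
  { intros H0. apply Hq. replace q with ((q - 1) + 1)%C by ring. rewrite H0. ring. }
  replace (Csum (fun k => q ^ k)%C N) with (((q - 1) * Csum (fun k => q ^ k) N) / (q - 1))%C
    by (field; exact Hq1).
  rewrite E. field. exact Hq1.
Qed.

(** Induction on the number of coefficients: adding [b K] creates cross terms with each [j < K], and
    these vanish after summation over the [N]-th roots of unity since [0 < K - j < N]. *)
Lemma discrete_parseval (b : nat -> C) (N K : nat) : (K <= N)%nat ->
  Rsum (fun k => Cmod (Csum (fun j => b j * (expi (2 * PI / INR N) ^ k) ^ j)%C K) ^ 2) N
  = INR N * Rsum (fun j => Cmod (b j) ^ 2) K.
Proof.
  set (w := expi (2 * PI / INR N)).
  assert (Hw : Cmod w = 1) by apply Cmod_expi.
  assert (Hwc : (w * Cconj w)%C = 1).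
  { rewrite <- Cmod2_conj, Hw. rewrite pow1; reflexivity. }
  induction K as [|K IH]; intros HK.
  - simpl. rewrite Rsum_const, Cmod_0. ring.
  - simpl Csum.
    rewrite (Rsum_ext _ (fun k =>
      (Cmod (Csum (fun j => b j * (w ^ k) ^ j)%C K) ^ 2 + Cmod (b K) ^ 2)
      + 2 * Re (Csum (fun j => Cconj (b K) * b j * Cconj (w ^ (k * (K - j))))%C K))).
    2: { intros k Hk. rewrite Cmod_sqr_plus, !Cmod_mult, !Cmod_pow, Hw, !pow1, Rmult_1_r.
         f_equal. f_equal. f_equal. rewrite <- Csum_scal. apply Csum_ext. intros j Hj.
         rewrite Cmult_conj, !Cpow_conj, <- !Cpow_mult_r.
         replace (k * K)%nat with (k * j + k * (K - j))%nat
           by (rewrite <- Nat.mul_add_distr_l; f_equal; lia).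
         rewrite Cpow_add_r.
         transitivity (Cconj (b K) * b j * Cconj w ^ (k * (K - j))
                       * (w ^ (k * j) * Cconj w ^ (k * j)))%C; [ring|].
         rewrite <- Cpow_mult_l, Hwc, Cpow_1_l. ring. }
    rewrite !Rsum_plus, IH by lia.
    rewrite Rsum_const, Rsum_scal, <- Re_Csum, Csum_swap.
    rewrite (Csum_ext _ (fun _ => RtoC 0)).
    + rewrite Csum_zero. simpl. ring.
    + intros j Hj. rewrite Csum_scal, <- Csum_conj.
      unfold w. rewrite root_of_unity_sum by lia.
      apply C_eq; simpl; ring.
Qed.

(** * Power series dominated by a geometric series *)

(** [psum a z] is convertible with [Cser] of the terms [a j * z ^ j], so facts about [Cser] apply to
    it directly. *)
Definition Cser (b : nat -> C) : C :=
  (Series (fun j => Re (b j)), Series (fun j => Im (b j))).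

Definition ex_Cser (b : nat -> C) : Prop :=
  ex_series (fun j => Re (b j)) /\ ex_series (fun j => Im (b j)).

Lemma Cser_ext (b c : nat -> C) : (forall j, b j = c j) -> Cser b = Cser c.
Proof. intros H. apply C_eq; simpl; apply Series_ext; intros; now rewrite H. Qed.

Lemma ex_Cser_plus (b c : nat -> C) :
  ex_Cser b -> ex_Cser c -> ex_Cser (fun j => b j + c j)%C.
Proof.
  intros [H1 H2] [H3 H4]. split.
  - exact (ex_series_plus _ _ H1 H3).
  - exact (ex_series_plus _ _ H2 H4).
Qed.

Lemma Cser_plus (b c : nat -> C) :
  ex_Cser b -> ex_Cser c -> Cser (fun j => b j + c j)%C = (Cser b + Cser c)%C.
Proof.
  intros [H1 H2] [H3 H4]. apply C_eq; simpl; now apply Series_plus.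
Qed.

Lemma ex_Cser_scal (u : C) (b : nat -> C) : ex_Cser b -> ex_Cser (fun j => u * b j)%C.
Proof.
  intros [H1 H2]. split.
  - apply (ex_series_minus (V := R_NormedModule) (fun j => Re u * Re (b j)) (fun j => Im u * Im (b j)));
      now apply (ex_series_scal (V := R_NormedModule)).
  - apply (ex_series_plus (V := R_NormedModule) (fun j => Re u * Im (b j)) (fun j => Im u * Re (b j)));
      now apply (ex_series_scal (V := R_NormedModule)).
Qed.

Lemma Cser_scal (u : C) (b : nat -> C) :
  ex_Cser b -> Cser (fun j => u * b j)%C = (u * Cser b)%C.
Proof.
  intros [H1 H2]. apply C_eq; simpl.
  - rewrite Series_minus by now apply (ex_series_scal (V := R_NormedModule)).
    now rewrite !Series_scal_l.
  - rewrite Series_plus by now apply (ex_series_scal (V := R_NormedModule)).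
    now rewrite !Series_scal_l.
Qed.

Lemma ex_Cser_geom (b : nat -> C) (A q : R) : 0 <= q < 1 ->
  (forall j, Cmod (b j) <= A * q ^ j) -> ex_Cser b.
Proof.
  intros Hq Hb.
  assert (G : ex_series (fun j => A * q ^ j)).
  { apply (ex_series_scal (V := R_NormedModule)). apply ex_series_geom.
    rewrite Rabs_pos_eq; lra. }
  split; (eapply (ex_series_le (V := R_CompleteNormedModule)); [|exact G]);
    intros j; (eapply Rle_trans; [|apply Hb]).
  - apply re_le_Cmod.
  - eapply Rle_trans; [|apply Rmax_Cmod]. apply Rmax_r.
Qed.

Lemma Csum_Cser (b : nat -> nat -> C) (n : nat) :
  (forall k, (k < n)%nat -> ex_Cser (b k)) ->
  ex_Cser (fun j => Csum (fun k => b k j) n)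
  /\ Cser (fun j => Csum (fun k => b k j) n) = Csum (fun k => Cser (b k)) n.
Proof.
  induction n as [|n IH]; intros H; simpl.
  - assert (E : ex_Cser (fun _ => RtoC 0)).
    { apply (ex_Cser_geom _ 0 0); [lra|]. intros j. rewrite Cmod_0; lra. }
    split; [exact E|].
    rewrite (Cser_ext _ (fun j => 0 * 0)%C) by (intros; ring).
    rewrite (Cser_scal 0 (fun _ => RtoC 0)) by exact E. ring.
  - destruct IH as [I1 I2]; [auto|]. split.
    + apply ex_Cser_plus; auto.
    + rewrite Cser_plus by auto. now rewrite I2.
Qed.

(* Testing against the conjugate of the sum itself reduces the triangle inequality to real series. *)
Lemma Cmod_Cser_le (b : nat -> C) (A q : R) : 0 <= q < 1 ->
  (forall j, Cmod (b j) <= A * q ^ j) -> Cmod (Cser b) <= A / (1 - q).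
Proof.
  intros Hq Hb. destruct (ex_Cser_geom b A q Hq Hb) as [E1 E2].
  set (S := Cser b).
  assert (HA : 0 <= A).
  { specialize (Hb O). simpl in Hb. pose proof (Cmod_ge_0 (b O)). lra. }
  assert (Hq' : Rabs q < 1) by (rewrite Rabs_pos_eq; lra).
  assert (H : Cmod S ^ 2 <= Cmod S * (A / (1 - q))).
  { replace (Cmod S ^ 2) with (Series (fun j => Re S * Re (b j) + Im S * Im (b j))).
    2: { rewrite Series_plus, !Series_scal_l
           by now apply (ex_series_scal (V := R_NormedModule)).
         rewrite Cmod2_alt. unfold S, Cser; simpl. ring. }
    replace (Cmod S * (A / (1 - q))) with (Series (fun j => Cmod S * A * q ^ j)).
    2: { rewrite Series_scal_l, Series_geom by exact Hq'. unfold Rdiv; ring. }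
    assert (G : ex_series (fun j => Cmod S * A * q ^ j)).
    { apply (ex_series_scal (V := R_NormedModule)). now apply ex_series_geom. }
    assert (L : forall j, Rabs (Re S * Re (b j) + Im S * Im (b j)) <= Cmod S * A * q ^ j).
    { intros j.
      replace (Re S * Re (b j) + Im S * Im (b j)) with (Re (S * Cconj (b j))%C)
        by (rewrite re_mult, re_conj, im_conj; ring).
      eapply Rle_trans; [apply re_le_Cmod|].
      rewrite Cmod_mult, Cmod_conj, Rmult_assoc.
      apply Rmult_le_compat_l; [apply Cmod_ge_0|apply Hb]. }
    assert (G' : ex_series (fun j => Rabs (Re S * Re (b j) + Im S * Im (b j)))).
    { eapply (ex_series_le (V := R_CompleteNormedModule)); [|exact G].
      intros j. unfold norm; simpl; unfold abs; simpl. rewrite Rabs_Rabsolu. apply L. }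
    eapply Rle_trans; [apply Rle_abs|].
    eapply Rle_trans; [apply Series_Rabs, G'|].
    apply Series_le; [|exact G].
    intros j; split; [apply Rabs_pos|apply L]. }
  assert (0 <= A / (1 - q)) by (apply Rdiv_le_0_compat; lra).
  pose proof (Cmod_ge_0 S). nra.
Qed.

Lemma Cser_split (b : nat -> C) (K : nat) : ex_Cser b ->
  Cser b = (Csum b K + Cser (fun j => b (K + j)%nat))%C.
Proof.
  assert (W : forall a : nat -> R, ex_series a ->
            Series a = Rsum a K + Series (fun j => a (K + j)%nat)).
  { intros a Ha. induction K as [|K IH]; simpl.
    - rewrite Rplus_0_l. now apply Series_ext.
    - rewrite IH, Series_incr_1 by now apply ex_series_incr_n.
      rewrite Nat.add_0_r, Rplus_assoc. f_equal. f_equal.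
      apply Series_ext; intros; f_equal; lia. }
  intros [H1 H2]. apply C_eq.
  - rewrite re_plus, Re_Csum. apply (W _ H1).
  - change (Im (Csum b K + Cser (fun j => b (K + j)%nat))%C)
      with (Im (Csum b K) + Im (Cser (fun j => b (K + j)%nat))).
    rewrite Im_Csum. apply (W _ H2).
Qed.

Lemma Cser_tail_le (b : nat -> C) (A q : R) (K : nat) : 0 <= q < 1 ->
  (forall j, Cmod (b j) <= A * q ^ j) ->
  Cmod (Cser b - Csum b K)%C <= A * q ^ K / (1 - q).
Proof.
  intros Hq Hb.
  rewrite (Cser_split b K) by now apply (ex_Cser_geom b A q).
  replace (Csum b K + Cser (fun j => b (K + j)%nat) - Csum b K)%C
    with (Cser (fun j => b (K + j)%nat)) by ring.
  apply Cmod_Cser_le; [exact Hq|].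
  intros j. rewrite Rmult_assoc, <- pow_add. apply Hb.
Qed.

(** * Square-summable coefficients of a bounded analytic function *)

Lemma ex_series_bounded (b : nat -> C) : ex_series (V := C_NormedModule) b ->
  exists A, forall j, Cmod (b j) <= A.
Proof.
  intros H. apply (Cauchy_ex_series (V := C_CompleteNormedModule)) in H.
  (* The Cauchy criterion with tolerance 1, applied to one-term blocks, bounds every term from index
     [N] on. *)
  destruct (H (mkposreal 1 Rlt_0_1)) as [N HN]. simpl in HN.
  exists (Rsum (fun j => Cmod (b j)) N + 1). intros j.
  assert (P : 0 <= Rsum (fun j => Cmod (b j)) N)
    by (apply Rsum_nonneg; intros; apply Cmod_ge_0).
  destruct (Nat.le_gt_cases N j) as [Hj|Hj].
  - specialize (HN j j Hj Hj). rewrite sum_n_n in HN.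
    change (Cmod (b j) < 1) in HN. lra.
  - pose proof (Rsum_term_le (fun j => Cmod (b j)) j N (fun i => Cmod_ge_0 _) Hj).
    simpl in *; lra.
Qed.

Lemma one_minus_pow_ge (d : R) (m : nat) : 0 <= d <= 1 -> 1 - INR m * d <= (1 - d) ^ m.
Proof.
  intros Hd. induction m as [|m IH].
  - simpl; lra.
  - rewrite S_INR; simpl. pose proof (pos_INR m).
    assert ((1 - d) * (1 - INR m * d) <= (1 - d) * (1 - d) ^ m)
      by (apply Rmult_le_compat_l; lra).
    nra.
Qed.

(** Parseval over the [K + 1]-st roots of unity for a Taylor polynomial on the circle of radius
    [rho]. The polynomial is within 1 of the bounded sum there, whence [B + 1]. *)
Lemma coef_sq_sum_radius (a : nat -> C) (B rho : R) (J : nat) :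
  0 < rho < 1 ->
  (forall z : C, Cmod z < 1 -> ex_series (V := C_NormedModule) (fun j => (a j * z ^ j)%C)) ->
  (forall z : C, Cmod z < 1 -> Cmod (psum a z) <= B) ->
  Rsum (fun j => Cmod (a j) ^ 2 * (rho ^ 2) ^ j) J <= (B + 1) ^ 2.
Proof.
  intros Hr Ha HB.
  (* Convergence at the larger radius [r1] bounds [a j * r1 ^ j], which gives geometric decay with
     ratio [rho / r1] on the circle of radius [rho]. *)
  set (r1 := (1 + rho) / 2).
  assert (Hr1 : rho < r1 < 1) by (unfold r1; lra).
  destruct (ex_series_bounded (fun j => a j * RtoC r1 ^ j)%C) as [A HA].
  { apply Ha. rewrite Cmod_R, Rabs_pos_eq; lra. }
  set (q := rho / r1).
  assert (Hq : 0 < q < 1).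
  { unfold q. split; [apply Rdiv_lt_0_compat; lra|]. apply Rlt_div_l; lra. }
  assert (Hqj : forall z, Cmod z = rho -> forall j, Cmod (a j * z ^ j)%C <= A * q ^ j).
  { intros z Hz j. rewrite Cmod_mult, Cmod_pow, Hz.
    replace rho with (r1 * q) by (unfold q; field; lra).
    rewrite Rpow_mult_distr, <- Rmult_assoc.
    apply Rmult_le_compat_r; [apply pow_le; lra|].
    specialize (HA j). rewrite Cmod_mult, Cmod_pow, Cmod_R, Rabs_pos_eq in HA by lra.
    exact HA. }
  assert (HA0 : 0 <= A) by (eapply Rle_trans; [apply Cmod_ge_0|apply (HA O)]).
  (* The truncation order [K] makes the tail at most 1; dividing by [A + 1] also covers [A = 0]. *)
  assert (E : exists K, (J <= K)%nat /\ A * q ^ K / (1 - q) <= 1).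
  { destruct (pow_lt_1_zero q (ltac:(rewrite Rabs_pos_eq; lra)) ((1 - q) / (A + 1)))
      as [K0 HK0]; [apply Rdiv_lt_0_compat; lra|].
    exists (J + K0)%nat. split; [lia|].
    specialize (HK0 (J + K0)%nat (ltac:(lia))).
    rewrite Rabs_pos_eq in HK0 by (apply pow_le; lra).
    apply Rlt_div_r in HK0; [|lra].
    assert (0 <= q ^ (J + K0)) by (apply pow_le; lra).
    apply Rle_div_l; [lra|]. nra. }
  destruct E as [K [HJK HK]].
  apply Rle_trans with (Rsum (fun j => Cmod (a j) ^ 2 * (rho ^ 2) ^ j) K).
  { apply Rsum_mono; [|exact HJK]. intros j.
    apply Rmult_le_pos; [apply pow2_ge_0|apply pow_le, pow2_ge_0]. }
  assert (HN : 0 < INR (S K)) by (apply lt_0_INR; lia).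
  apply Rmult_le_reg_l with (INR (S K)); [exact HN|].
  assert (P := discrete_parseval (fun j => a j * RtoC rho ^ j)%C (S K) K (ltac:(lia))).
  rewrite (Rsum_ext (fun j => Cmod (a j) ^ 2 * (rho ^ 2) ^ j)
             (fun j => Cmod (a j * RtoC rho ^ j) ^ 2)).
  2: { intros j _. rewrite Cmod_mult, Cmod_pow, Cmod_R, Rabs_pos_eq by lra.
       rewrite Rpow_mult_distr, <- !pow_mult. f_equal. f_equal. lia. }
  rewrite <- P, <- Rsum_const. apply Rsum_le. intros k _.
  set (w := (expi (2 * PI / INR (S K)) ^ k)%C).
  assert (Hw : Cmod (RtoC rho * w) = rho).
  { unfold w. rewrite Cmod_mult, Cmod_pow, Cmod_expi, pow1, Cmod_R, Rabs_pos_eq; lra. }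
  rewrite (Csum_ext _ (fun j => a j * (RtoC rho * w) ^ j)%C)
    by (intros; rewrite Cpow_mult_l; ring).
  assert (T := Cser_tail_le (fun j => a j * (RtoC rho * w) ^ j)%C A q K
                 (ltac:(lra)) (Hqj _ Hw)).
  assert (HBz : Cmod (Cser (fun j => a j * (RtoC rho * w) ^ j)%C) <= B)
    by (apply HB; rewrite Hw; lra).
  set (S1 := Cser _) in *. set (P1 := Csum _ _) in *.
  assert (Cmod P1 <= Cmod S1 + Cmod (S1 - P1)%C).
  { replace P1 with (S1 + - (S1 - P1))%C at 1 by ring.
    eapply Rle_trans; [apply Cmod_triangle|]. rewrite Cmod_opp. lra. }
  pose proof (Cmod_ge_0 P1). apply pow_incr. lra.
Qed.

(** The limit of radius tending to 1, made quantitative: if the sum [X] exceeded [D], a radius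
    [1 - d] close enough to 1 would already violate the bound for that radius. *)
Lemma coef_sq_sum_le (a : nat -> C) (B : R) (J : nat) :
  (forall z : C, Cmod z < 1 -> ex_series (V := C_NormedModule) (fun j => (a j * z ^ j)%C)) ->
  (forall z : C, Cmod z < 1 -> Cmod (psum a z) <= B) ->
  Rsum (fun j => Cmod (a j) ^ 2) J <= (B + 1) ^ 2.
Proof.
  intros Ha HB. set (X := Rsum _ _). set (D := (B + 1) ^ 2).
  apply Rnot_lt_le. intros HX.
  assert (HD : 0 <= D) by apply pow2_ge_0.
  pose proof (pos_INR J) as HJ.
  (* By Bernoulli's inequality the weights cost at most [2 * J * d * X], and this [d] keeps the cost
     within [(X - D) / 2]. *)
  set (d := (X - D) / (4 * (INR J + 1) * X)).
  assert (Hd : 0 < d < 1).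
  { unfold d. split.
    - apply Rdiv_lt_0_compat; [lra|]. nra.
    - apply Rlt_div_l; nra. }
  assert (R1 := coef_sq_sum_radius a B (1 - d) J (ltac:(lra)) Ha HB).
  assert (R2 : X * (1 - 2 * INR J * d) <= Rsum (fun j => Cmod (a j) ^ 2 * ((1 - d) ^ 2) ^ j) J).
  { unfold X. rewrite Rmult_comm, <- Rsum_scal. apply Rsum_le. intros j Hj.
    rewrite Rmult_comm. apply Rmult_le_compat_l; [apply pow2_ge_0|].
    rewrite <- pow_mult.
    eapply Rle_trans; [|apply one_minus_pow_ge; lra].
    rewrite mult_INR. simpl (INR 2). apply lt_INR in Hj. nra. }
  fold D in R1.
  assert (R3 : X * (2 * INR J * d) = (X - D) * (INR J / (INR J + 1)) / 2)
    by (unfold d; field; lra).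
  assert (R4 : INR J / (INR J + 1) <= 1) by (apply Rle_div_l; lra).
  nra.
Qed.

Lemma coef_le (a : nat -> C) (D : R) : 0 <= D ->
  (forall J, Rsum (fun j => Cmod (a j) ^ 2) J <= D ^ 2) -> forall j, Cmod (a j) <= D.
Proof.
  intros HD H j.
  assert (Cmod (a j) ^ 2 <= D ^ 2).
  { eapply Rle_trans; [|apply (H (S j))].
    apply (Rsum_term_le (fun j => Cmod (a j) ^ 2)); [intros; apply pow2_ge_0|lia]. }
  pose proof (Cmod_ge_0 (a j)). nra.
Qed.

Lemma inv_sq_sum_le (n : nat) : Rsum (fun j => / INR (S j) ^ 2) n <= 2.
Proof.
  (* The strengthened bound is the one that telescopes. *)
  assert (H : forall n, Rsum (fun j => / INR (S j) ^ 2) (S n) <= 2 - / INR (S n)).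
  { clear n. induction n as [|n IH].
    - simpl. lra.
    - change (Rsum (fun j => / INR (S j) ^ 2) (S n) + / INR (S (S n)) ^ 2
              <= 2 - / INR (S (S n))).
      set (x := INR (S n)) in *.
      assert (Hx : 0 < x) by (apply lt_0_INR; lia).
      replace (INR (S (S n))) with (x + 1) by (unfold x; rewrite (S_INR (S n)); ring).
      assert (E : / x - / (x + 1) - / (x + 1) ^ 2 = / (x * (x + 1) ^ 2)) by (field; lra).
      assert (0 < / (x * (x + 1) ^ 2)) by (apply Rinv_0_lt_compat; nra).
      lra. }
  destruct n as [|n]; [simpl; lra|].
  specialize (H n). assert (0 < / INR (S n)) by (apply Rinv_0_lt_compat, lt_0_INR; lia).
  lra.
Qed.

(** AM-GM bounds each term by half of [|a_j|^2 + 1/(j+1)^2], and the inverse squares sum to at most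
    2. *)
Lemma hardy_sum_le (a : nat -> C) (D : R) :
  (forall J, Rsum (fun j => Cmod (a j) ^ 2) J <= D) ->
  forall J, Rsum (fun j => Cmod (a j) / INR (S j)) J <= D / 2 + 1.
Proof.
  intros H J.
  apply Rle_trans with (Rsum (fun j => / 2 * Cmod (a j) ^ 2 + / 2 * / INR (S j) ^ 2) J).
  - apply Rsum_le. intros j _. unfold Rdiv.
    rewrite <- pow_inv. pose proof (pow2_ge_0 (Cmod (a j) - / INR (S j))). nra.
  - rewrite Rsum_plus, !Rsum_scal. pose proof (inv_sq_sum_le J). specialize (H J). lra.
Qed.

(** * Newton's identities and the coefficients of exp of a primitive *)

Definition power_sum (lam : nat -> C) (N j : nat) : C := Csum (fun k => lam k ^ j)%C N.

(* Synthetic division of [p] by [1 - l X], where [1 / l = z] is a root of [p]. *)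
Definition deflate (l z : C) (p : nat -> C) (m : nat) : C :=
  (l ^ m * Csum (fun i => p i * z ^ i) (S m))%C.

Lemma deflate_0 (l z : C) (p : nat -> C) : deflate l z p 0 = p O.
Proof. unfold deflate; simpl; ring. Qed.

Lemma deflate_S (l z : C) (p : nat -> C) (m : nat) : (l * z)%C = 1 ->
  deflate l z p (S m) = (p (S m) + l * deflate l z p m)%C.
Proof.
  intros H. unfold deflate.
  change (Csum (fun i => p i * z ^ i) (S (S m)))%C
    with (Csum (fun i => p i * z ^ i) (S m) + p (S m) * z ^ S m)%C.
  transitivity (p (S m) * (l ^ S m * z ^ S m) + l ^ S m * Csum (fun i => p i * z ^ i) (S m))%C;
    [ring|].
  rewrite <- Cpow_mult_l, H, Cpow_1_l, Cpow_S. ring.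
Qed.

Lemma Csum_extend (a : nat -> C) (m n : nat) : (m <= n)%nat ->
  (forall j, (m <= j)%nat -> a j = 0) -> Csum a n = Csum a m.
Proof.
  intros Hmn H. replace n with (m + (n - m))%nat by lia. rewrite Csum_split.
  rewrite (Csum_ext (fun j => a (m + j)%nat) (fun _ => RtoC 0)) by (intros; apply H; lia).
  rewrite Csum_zero. ring.
Qed.

(** These are the coefficients of [p' = - p * sum_k lam_k / (1 - lam_k X)]. Induction on the number
    of roots: write [p = (1 - l X) q] by synthetic division and apply the hypothesis to [q]. *)
Lemma newton_identities (N : nat) : forall (z lam p : nat -> C),
  (forall m, (N < m)%nat -> p m = 0) ->
  (forall k, (k < N)%nat -> (lam k * z k)%C = 1) ->
  (forall k l, (k < l)%nat -> (l < N)%nat -> z k <> z l) ->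
  (forall k, (k < N)%nat -> Csum (fun m => p m * z k ^ m)%C (S N) = 0) ->
  forall m, (RtoC (INR (S m)) * p (S m)
             + Csum (fun i => power_sum lam N (S i) * p (m - i)%nat) (S m))%C = 0.
Proof.
  induction N as [|N IH]; intros z lam p Hp Hlz Hz Hroot m.
  - rewrite Hp by lia.
    rewrite (Csum_ext _ (fun _ => RtoC 0))
      by (intros; unfold power_sum; simpl; ring).
    rewrite Csum_zero. ring.
  - set (l := lam N). set (q := deflate l (z N) p).
    assert (Hl : (l * z N)%C = 1) by (apply Hlz; lia).
    assert (q0 : q O = p O) by apply deflate_0.
    assert (qS : forall m, p (S m) = (q (S m) - l * q m)%C).
    { intros i. unfold q. rewrite deflate_S by exact Hl. ring. }
    (* Past degree [N] the partial sum in [deflate] is the full value of [p] at its root [z N]. *)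
    assert (Hq : forall m, (N < m)%nat -> q m = 0).
    { intros i Hi. unfold q, deflate.
      rewrite (Csum_extend _ (S (S N)) (S i)).
      - rewrite Hroot by lia. ring.
      - lia.
      - intros j Hj. rewrite Hp by lia. ring. }
    (* At [z k] the factor [1 - l * z k] is nonzero because [z k <> z N], so the root passes to
       [q]. *)
    assert (Hqroot : forall k, (k < N)%nat -> Csum (fun m => q m * z k ^ m)%C (S N) = 0).
    { intros k Hk. specialize (Hroot k (ltac:(lia))).
      assert (E : ((1 - l * z k) * Csum (fun m => q m * z k ^ m) (S N))%C = 0).
      { rewrite <- Hroot. rewrite (Csum_S_l _ (S N)).
        rewrite (Csum_ext (fun j => p (S j) * z k ^ S j)%C
          (fun j => q (S j) * z k ^ S j + (- (l * z k)) * (q j * z k ^ j))%C).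
        2: { intros j _. rewrite qS, Cpow_S. ring. }
        rewrite Csum_plus, Csum_scal.
        assert (X : Csum (fun j => q j * z k ^ j)%C (S (S N))
                    = Csum (fun j => q j * z k ^ j)%C (S N)).
        { apply Csum_extend; [lia|]. intros j Hj. rewrite Hq by lia. ring. }
        rewrite (Csum_S_l _ (S N)) in X.
        rewrite <- q0.
        transitivity (Csum (fun j => q j * z k ^ j) (S N)
          - l * z k * Csum (fun j => q j * z k ^ j) (S N))%C; [ring|].
        rewrite <- X at 1. ring. }
      assert (H1 : (1 - l * z k)%C <> 0).
      { intros H0. apply (Hz k N); [lia|lia|].
        assert (Hk1 : (l * z k)%C = 1).
        { transitivity (1 - (1 - l * z k))%C; [ring|]. rewrite H0. ring. }
        transitivity (l * z N * z k)%C; [rewrite Hl; ring|].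
        transitivity (l * z k * z N)%C; [ring|]. rewrite Hk1. ring. }
      transitivity (/ (1 - l * z k) * ((1 - l * z k) * Csum (fun m => q m * z k ^ m) (S N)))%C.
      - field. exact H1.
      - rewrite E. ring. }
    assert (HI := IH z lam q Hq (fun k Hk => Hlz k (ltac:(lia)))
                    (fun k i Hk Hi => Hz k i Hk (ltac:(lia))) Hqroot).
    (* The coefficient form of [p * l / (1 - l X) = l q]: the contribution of the root split off. *)
    assert (T1 : forall m, Csum (fun i => l ^ S i * p (m - i)%nat)%C (S m) = (l * q m)%C).
    { induction m0 as [|m0 IHm].
      - simpl. rewrite q0. ring.
      - rewrite Csum_S_l.
        rewrite (Csum_ext _ (fun i => l * (l ^ S i * p (m0 - i)%nat))%C)
          by (intros i _; simpl; ring).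
        rewrite Csum_scal, IHm, Nat.sub_0_r, qS. simpl. ring. }
    assert (T2 : Csum (fun i => power_sum lam N (S i) * p (m - i)%nat)%C (S m)
      = (Csum (fun i => power_sum lam N (S i) * q (m - i)%nat)%C (S m)
         + (- l) * Csum (fun i => power_sum lam N (S i) * q (m - 1 - i)%nat)%C m)%C).
    { simpl. rewrite Nat.sub_diag, q0.
      rewrite (Csum_ext (fun i => power_sum lam N (S i) * p (m - i)%nat)%C
        (fun i => power_sum lam N (S i) * q (m - i)%nat
                  + (- l) * (power_sum lam N (S i) * q (m - 1 - i)%nat))%C).
      - rewrite Csum_plus, Csum_scal. ring.
      - intros i Hi. replace (m - i)%nat with (S (m - 1 - i)) by lia.
        rewrite qS. ring. }
    rewrite (Csum_ext _ (fun i => power_sum lam N (S i) * p (m - i)%nat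
                                  + l ^ S i * p (m - i)%nat)%C)
      by (intros; unfold power_sum; simpl; fold l; ring).
    rewrite Csum_plus, T1, T2, qS.
    assert (HIm := HI m).
    assert (HI1 : (Csum (fun i => power_sum lam N (S i) * q (m - 1 - i)%nat) m
                   = - (RtoC (INR m) * q m))%C).
    { destruct m as [|m']; [simpl; ring|].
      specialize (HI m').
      rewrite (Csum_ext _ (fun i => power_sum lam N (S i) * q (m' - i)%nat)%C)
        by (intros; do 2 f_equal; lia).
      transitivity ((RtoC (INR (S m')) * q (S m')
             + Csum (fun i => power_sum lam N (S i) * q (m' - i)%nat) (S m'))
             - RtoC (INR (S m')) * q (S m'))%C; [ring|]. rewrite HI. ring. }
    rewrite HI1.
    transitivity ((RtoC (INR (S m)) * q (S m)
             + Csum (fun i => power_sum lam N (S i) * q (m - i)%nat) (S m))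
       + l * q m * (RtoC (INR m) + 1 - RtoC (INR (S m))))%C; [ring|].
    rewrite HIm, S_INR, RtoC_plus. ring.
Qed.

(** The system is triangular with diagonal [p 0 = 1], so it is solved by strong induction. *)
Lemma convolution_unique (s a p : nat -> C) (n : nat) : p O = 1 ->
  (forall m, (m < n)%nat -> Csum (fun i => s i * p (m - i)%nat)%C (S m)
                          = Csum (fun i => a i * p (m - i)%nat)%C (S m)) ->
  forall m, (m < n)%nat -> s m = a m.
Proof.
  intros p0 H m. induction m as [m IH] using lt_wf_ind. intros Hm.
  specialize (H m Hm). simpl in H. rewrite Nat.sub_diag, p0 in H.
  rewrite (Csum_ext _ (fun i => a i * p (m - i)%nat)%C) in H
    by (intros; rewrite IH by lia; reflexivity).
  set (X := Csum _ _) in H.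
  transitivity (X + s m * 1 - X)%C; [ring|]. rewrite H. ring.
Qed.

(** * Taylor coefficients of the exponential of a primitive *)

Lemma history_recursion (T : Type) (x0 : T) (step : nat -> (nat -> T) -> T) :
  (forall m u v, (forall k, (k <= m)%nat -> u k = v k) -> step m u = step m v) ->
  exists u, u O = x0 /\ forall m, u (S m) = step m u.
Proof.
  intros Hext.
  (* [tab n] is a table correct up to index [n]. As [step m] looks only at indices up to [m], it
     cannot tell the table from the diagonal sequence. *)
  set (tab := fix tab (n : nat) : nat -> T := match n with
    | O => fun _ => x0
    | S m => fun k => if Nat.leb k m then tab m k else step m (tab m) end).
  assert (H : forall n k, (k <= n)%nat -> tab n k = tab k k).
  { induction n as [|n IH]; intros k Hk.
    - now replace k with O by lia.
    - destruct (Nat.eq_dec k (S n)) as [->|E]; [reflexivity|].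
      simpl. rewrite (proj2 (Nat.leb_le k n)) by lia. apply IH; lia. }
  exists (fun n => tab n n). split; [reflexivity|].
  intros m. cbn [tab]. rewrite (proj2 (Nat.leb_gt (S m) m)) by lia.
  apply Hext. intros k Hk. now apply H.
Qed.

(* The Taylor coefficients of [exp (int_0^z g)], characterised by [E' = g E], [E 0 = 1]. *)
Definition exp_integral_coefs (g e : nat -> C) : Prop :=
  e O = 1 /\ forall m, (RtoC (INR (S m)) * e (S m))%C
                       = Csum (fun i => g i * e (m - i)%nat)%C (S m).

Lemma RtoC_INR_S_neq_0 (m : nat) : RtoC (INR (S m)) <> 0.
Proof. intros H. apply RtoC_inj in H. revert H. apply not_0_INR. lia. Qed.

Lemma exp_integral_coefs_exist (g : nat -> C) : exists e, exp_integral_coefs g e.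
Proof.
  destruct (history_recursion C 1
    (fun m u => / RtoC (INR (S m)) * Csum (fun i => g i * u (m - i)%nat) (S m))%C)
    as [e [e0 eS]].
  - intros m u v H. f_equal. apply Csum_ext. intros i Hi. rewrite H by lia. reflexivity.
  - exists e. split; [exact e0|]. intros m. rewrite eS. field. apply RtoC_INR_S_neq_0.
Qed.

(** The function [w -> E (z w)] solves the equation with [z g (z w)] in place of [g (w)]. This moves
    any point of the unit circle to 1, so that integration over the real segment from 0 to 1
    suffices. *)
Lemma exp_integral_coefs_rotate (g e : nat -> C) (z : C) : exp_integral_coefs g e ->
  exp_integral_coefs (fun i => g i * z ^ S i)%C (fun j => e j * z ^ j)%C.
Proof.
  intros [e0 eS]. split; [rewrite e0; simpl; ring|].
  intros m. rewrite Cmult_assoc, eS, Cmult_comm, <- Csum_scal.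
  apply Csum_ext. intros i Hi.
  replace (S m) with (S i + (m - i))%nat by lia. rewrite Cpow_add_r. ring.
Qed.

(** * Taylor polynomials of the exponential on the unit circle *)

Lemma is_derive_Rsum (f : nat -> R -> R) (df : nat -> R) (n : nat) (t : R) :
  (forall j, (j < n)%nat -> is_derive (f j) t (df j)) ->
  is_derive (fun s => Rsum (fun j => f j s) n) t (Rsum df n).
Proof.
  induction n as [|n IH]; intros H; simpl.
  - apply (is_derive_const (V := R_NormedModule) 0).
  - apply (is_derive_plus (V := R_NormedModule) (fun s => Rsum (fun j => f j s) n)); auto.
Qed.

Lemma is_derive_monomial (c : R) (j : nat) (t : R) :
  is_derive (fun s => c * s ^ S j) t (INR (S j) * c * t ^ j).
Proof.
  auto_derive; [trivial|]. change (Init.Nat.pred (S j)) with j.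
  rewrite S_INR. destruct j; simpl; ring.
Qed.

Lemma is_derive_poly (c : nat -> R) (n : nat) (t : R) :
  is_derive (fun s => Rsum (fun j => c j * s ^ j) (S n)) t
            (Rsum (fun j => INR (S j) * c (S j) * t ^ j) n).
Proof.
  induction n as [|n IH].
  - simpl. auto_derive; [trivial|ring].
  - apply (is_derive_plus (V := R_NormedModule)
      (fun s => Rsum (fun j => c j * s ^ j) (S n)) (fun s => c (S n) * s ^ S n)).
    + exact IH.
    + apply is_derive_monomial.
Qed.

Lemma is_derive_primitive (c : nat -> R) (n : nat) (t : R) :
  is_derive (fun s => Rsum (fun i => c i / INR (S i) * s ^ S i) n) t
            (Rsum (fun i => c i * t ^ i) n).
Proof.
  apply is_derive_Rsum. intros i _.
  replace (c i * t ^ i) with (INR (S i) * (c i / INR (S i)) * t ^ i).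
  - apply is_derive_monomial.
  - field. apply not_0_INR; lia.
Qed.

Lemma derive_nonneg_le (f df : R -> R) :
  (forall t, is_derive f t (df t)) -> (forall t, 0 <= t <= 1 -> 0 <= df t) -> f 0 <= f 1.
Proof.
  intros Hd Hp. destruct (MVT_gen f 0 1 df) as [c [Hc E]].
  - intros; apply Hd.
  - intros x _. apply derivable_continuous_pt. exists (df x). apply is_derive_Reals, Hd.
  - rewrite Rmin_left, Rmax_right in Hc by lra. specialize (Hp c Hc). lra.
Qed.

Lemma Rsum_at_0 (c : nat -> R) (n : nat) : Rsum (fun j => c j * 0 ^ j) (S n) = c O.
Proof.
  induction n as [|n IH]; [simpl; ring|].
  change (Rsum (fun j => c j * 0 ^ j) (S n) + c (S n) * 0 ^ S n = c O).
  rewrite IH; simpl; ring.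
Qed.

Lemma Rsum_S_pow_at_0 (c : nat -> R) (n : nat) : Rsum (fun i => c i * 0 ^ S i) n = 0.
Proof.
  rewrite (Rsum_ext _ (fun _ => 0)) by (intros; simpl; ring).
  rewrite Rsum_const; ring.
Qed.

Lemma Rsum_mult (a b : nat -> R) (m n : nat) :
  Rsum a m * Rsum b n = Rsum (fun i => Rsum (fun j => a i * b j) n) m.
Proof.
  rewrite Rmult_comm, <- Rsum_scal. apply Rsum_ext. intros i _.
  rewrite Rmult_comm, <- Rsum_scal. reflexivity.
Qed.

Lemma is_derive_mult_exp_opp (s G : R -> R) (ds dG t : R) :
  is_derive s t ds -> is_derive G t dG ->
  is_derive (fun x => s x * exp (- G x)) t ((ds - dG * s t) * exp (- G t)).
Proof.
  intros Hs HG. auto_derive.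
  - repeat split; eexists; eassumption.
  - assert (E1 : Derive (fun x : R => s x) t = ds) by now apply is_derive_unique.
    assert (E2 : Derive (fun x : R => G x) t = dG) by now apply is_derive_unique.
    rewrite E1, E2. ring.
Qed.

(** With [s] the polynomial of [u] and [G] the primitive of the polynomial of [gam], the recurrence
    gives [s' <= G' s] on [[0, 1]]. Hence [s exp (- G)] decreases, and [s 1 <= exp (G 1)]. *)
Lemma exp_integral_majorant (gam u : nat -> R) (L : R) (n : nat) :
  (forall i, 0 <= gam i) -> (forall j, 0 <= u j) -> u O <= 1 ->
  (forall m, INR (S m) * u (S m) <= Rsum (fun i => gam i * u (m - i)%nat) (S m)) ->
  Rsum (fun i => gam i / INR (S i)) n <= L ->
  Rsum u (S n) <= exp L.
Proof.
  intros Hg Hu u0 uS HL.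
  set (s := fun t => Rsum (fun j => u j * t ^ j) (S n)).
  set (G := fun t => Rsum (fun i => gam i / INR (S i) * t ^ S i) n).
  set (ds := fun t => Rsum (fun j => INR (S j) * u (S j) * t ^ j) n).
  set (dG := fun t => Rsum (fun i => gam i * t ^ i) n).
  assert (Hs : forall t, is_derive s t (ds t)) by (intros; apply is_derive_poly).
  assert (HG : forall t, is_derive G t (dG t)) by (intros; apply is_derive_primitive).
  (* The recurrence yields the triangle [i + j < n] of the product; the remaining terms of the full
     product are nonnegative. *)
  assert (K : forall t, 0 <= t <= 1 -> ds t <= dG t * s t).
  { intros t Ht.
    apply Rle_trans with
      (Rsum (fun m => Rsum (fun i => gam i * t ^ i * (u (m - i)%nat * t ^ (m - i))) (S m)) n).
    - apply Rsum_le. intros m _.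
      rewrite (Rsum_ext (fun i => gam i * t ^ i * (u (m - i)%nat * t ^ (m - i)))
                        (fun i => t ^ m * (gam i * u (m - i)%nat))).
      + rewrite Rsum_scal, Rmult_comm. apply Rmult_le_compat_l; [apply pow_le; lra|apply uS].
      + intros i Hi. replace m with (i + (m - i))%nat at 3 by lia. rewrite pow_add. ring.
    - rewrite (Rsum_triangle (fun i j => gam i * t ^ i * (u j * t ^ j))).
      unfold dG, s. rewrite Rsum_mult. apply Rsum_le. intros i Hi.
      apply Rsum_mono; [|lia]. intros j.
      pose proof (pow_le t i (proj1 Ht)). pose proof (pow_le t j (proj1 Ht)).
      repeat apply Rmult_le_pos; auto. }
  assert (M : - (s 0 * exp (- G 0)) <= - (s 1 * exp (- G 1))).
  { apply (derive_nonneg_le (fun t => - (s t * exp (- G t)))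
      (fun t => (dG t * s t - ds t) * exp (- G t))).
    - intros t. replace ((dG t * s t - ds t) * exp (- G t))
        with (- ((ds t - dG t * s t) * exp (- G t))) by ring.
      apply (is_derive_opp (V := R_NormedModule)), is_derive_mult_exp_opp; auto.
    - intros t Ht. apply Rmult_le_pos; [specialize (K t Ht); lra|left; apply exp_pos]. }
  assert (s0 : s 0 = u O) by apply Rsum_at_0.
  assert (G0 : G 0 = 0)
    by (apply (Rsum_S_pow_at_0 (fun i => gam i / INR (S i)))).
  assert (s1 : s 1 = Rsum u (S n))
    by (apply Rsum_ext; intros; rewrite pow1; ring).
  assert (G1 : G 1 <= L).
  { eapply Rle_trans; [|exact HL]. apply Req_le, Rsum_ext. intros; rewrite pow1; ring. }
  rewrite s0, G0, s1, Ropp_0, exp_0 in M.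
  assert (E : exp (- G 1) * exp (G 1) = 1) by (rewrite <- exp_plus, Rplus_opp_l; apply exp_0).
  assert (exp (G 1) <= exp L).
  { destruct G1 as [G1|G1]; [left; now apply exp_increasing|rewrite G1; lra]. }
  pose proof (exp_pos (G 1)).
  replace (Rsum u (S n)) with (Rsum u (S n) * exp (- G 1) * exp (G 1))
    by (rewrite Rmult_assoc, E; ring).
  nra.
Qed.

Lemma exp_integral_coefs_summable (g e : nat -> C) (L : R) : exp_integral_coefs g e ->
  (forall J, Rsum (fun i => Cmod (g i) / INR (S i)) J <= L) ->
  forall J, Rsum (fun j => Cmod (e j)) J <= exp L.
Proof.
  intros [e0 eS] HL J.
  apply Rle_trans with (Rsum (fun j => Cmod (e j)) (S J)).
  - apply Rsum_mono; [intros; apply Cmod_ge_0|lia].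
  - apply (exp_integral_majorant (fun i => Cmod (g i))); auto using Cmod_ge_0.
    + rewrite e0, Cmod_1; lra.
    + intros m. rewrite <- (Rabs_pos_eq (INR (S m))) by apply pos_INR.
      rewrite <- Cmod_R, <- Cmod_mult, eS.
      eapply Rle_trans; [apply Cmod_Csum_le|].
      apply Req_le, Rsum_ext. intros; apply Cmod_mult.
Qed.

(* The product of the truncations exceeds the
   derivative exactly by the terms of degree at least [n]. *)
Lemma truncated_ode (g e : nat -> C) (n : nat) (t : R) : exp_integral_coefs g e ->
  (Csum (fun j => RtoC (INR (S j)) * e (S j) * t ^ j) n
   - Csum (fun i => g i * t ^ i) n * Csum (fun j => e j * t ^ j) (S n)
   = - Csum (fun i => Csum (fun j => g i * e (n - i + j)%nat * t ^ (n + j)) (S i)) n)%C.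
Proof.
  intros [e0 eS].
  set (phi := fun i j => (g i * t ^ i * (e j * t ^ j))%C).
  assert (E1 : (Csum (fun j => RtoC (INR (S j)) * e (S j) * t ^ j) n
               = Csum (fun i => Csum (fun j => phi i j) (n - i)) n)%C).
  { rewrite <- Csum_triangle. apply Csum_ext. intros m _.
    rewrite eS, Cmult_comm, <- Csum_scal. apply Csum_ext. intros i Hi. unfold phi.
    replace m with (i + (m - i))%nat at 1 by lia. rewrite Cpow_add_r. ring. }
  assert (E2 : (Csum (fun i => g i * t ^ i) n * Csum (fun j => e j * t ^ j) (S n)
    = Csum (fun i => Csum (fun j => phi i j) (n - i)) n
      + Csum (fun i => Csum (fun j => g i * e (n - i + j)%nat * t ^ (n + j)) (S i)) n)%C).
  { rewrite Cmult_comm, <- Csum_scal, <- Csum_plus. apply Csum_ext. intros i Hi.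
    rewrite Cmult_comm, <- Csum_scal.
    change (Csum (fun j => phi i j) (S n) = Csum (fun j => phi i j) (n - i)
      + Csum (fun j => g i * e (n - i + j)%nat * t ^ (n + j)) (S i))%C.
    replace (S n) with ((n - i) + S i)%nat by lia. rewrite Csum_split. f_equal.
    apply Csum_ext. intros j _. unfold phi.
    replace (n + j)%nat with (i + (n - i + j))%nat by lia. rewrite (Cpow_add_r _ i). ring. }
  rewrite E1, E2. ring.
Qed.

(** The function is the real part of [S exp (- G)] with [S = X + i Y] and [G = A + i B], and its
    derivative is the real part of [(S' - G' S) exp (- G)]. *)
Lemma is_derive_twisted (A B X Y : R -> R) (dA dB dX dY t : R) :
  is_derive A t dA -> is_derive B t dB -> is_derive X t dX -> is_derive Y t dY ->
  is_derive (fun s => exp (- A s) * (X s * cos (B s) + Y s * sin (B s))) t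
    (exp (- A t) * ((dX - dA * X t + dB * Y t) * cos (B t)
                    + (dY - dA * Y t - dB * X t) * sin (B t))).
Proof.
  intros HA HB HX HY. auto_derive.
  - repeat split; eexists; eassumption.
  - assert (E1 : Derive (fun x : R => A x) t = dA) by now apply is_derive_unique.
    assert (E2 : Derive (fun x : R => B x) t = dB) by now apply is_derive_unique.
    assert (E3 : Derive (fun x : R => X x) t = dX) by now apply is_derive_unique.
    assert (E4 : Derive (fun x : R => Y x) t = dY) by now apply is_derive_unique.
    rewrite E1, E2, E3, E4. ring.
Qed.

Lemma Re_scal_pow (z : C) (t : R) (j : nat) : Re (z * RtoC t ^ j)%C = Re z * t ^ j.
Proof. rewrite <- RtoC_pow. apply re_scal_r. Qed.

Lemma Im_scal_pow (z : C) (t : R) (j : nat) : Im (z * RtoC t ^ j)%C = Im z * t ^ j.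
Proof. rewrite <- RtoC_pow, im_mult, re_RtoC, im_RtoC. ring. Qed.

(** The integral over [[0, 1]] of the termwise majorant of the remainder in [truncated_ode];
    [t ^ (n + j)] contributes [1 / (n + j + 1)]. *)
Definition ode_defect (g e : nat -> C) (n : nat) : R :=
  Rsum (fun i => Rsum (fun j => Cmod (g i) * Cmod (e (n - i + j)%nat) / INR (S (n + j))) (S i)) n.

(* Integrates [Re (s (t) exp (- G (t)))] over [[0, 1]], whose derivative is controlled by
   the remainder in [truncated_ode]. *)
Lemma taylor_quotient_re (g e : nat -> C) (L : R) (n : nat) : exp_integral_coefs g e ->
  (forall J, Rsum (fun i => Cmod (g i) / INR (S i)) J <= L) ->
  1 - exp L * ode_defect g e n
  <= exp (- Re (Csum (fun i => g i / RtoC (INR (S i)))%C n))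
     * Re (Csum e (S n) * Cconj (expi (Im (Csum (fun i => g i / RtoC (INR (S i)))%C n))))%C.
Proof.
  intros He HL.
  set (X := fun t => Rsum (fun j => Re (e j) * t ^ j) (S n)).
  set (Y := fun t => Rsum (fun j => Im (e j) * t ^ j) (S n)).
  set (A := fun t => Rsum (fun i => Re (g i) / INR (S i) * t ^ S i) n).
  set (B := fun t => Rsum (fun i => Im (g i) / INR (S i) * t ^ S i) n).
  set (dX := fun t => Rsum (fun j => INR (S j) * Re (e (S j)) * t ^ j) n).
  set (dY := fun t => Rsum (fun j => INR (S j) * Im (e (S j)) * t ^ j) n).
  set (dA := fun t => Rsum (fun i => Re (g i) * t ^ i) n).
  set (dB := fun t => Rsum (fun i => Im (g i) * t ^ i) n).
  assert (HX : forall t, is_derive X t (dX t)) by (intros; apply (is_derive_poly (fun j => Re (e j)))).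
  assert (HY : forall t, is_derive Y t (dY t)) by (intros; apply (is_derive_poly (fun j => Im (e j)))).
  assert (HA : forall t, is_derive A t (dA t)) by (intros; apply (is_derive_primitive (fun j => Re (g j)))).
  assert (HB : forall t, is_derive B t (dB t)) by (intros; apply (is_derive_primitive (fun j => Im (g j)))).
  set (f := fun s => exp (- A s) * (X s * cos (B s) + Y s * sin (B s))).
  set (df := fun t => exp (- A t) * ((dX t - dA t * X t + dB t * Y t) * cos (B t)
                    + (dY t - dA t * Y t - dB t * X t) * sin (B t))).
  assert (Hf : forall t, is_derive f t (df t)) by (intros; apply is_derive_twisted; auto).
  set (c := fun i j => Cmod (g i) * Cmod (e (n - i + j)%nat)).
  set (K := fun t => Rsum (fun i => Rsum (fun j =>
               c i j / INR (S (n + j)) * t ^ S (n + j)) (S i)) n).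
  set (dK := fun t => Rsum (fun i => Rsum (fun j => c i j * t ^ (n + j)) (S i)) n).
  assert (HK : forall t, is_derive K t (dK t)).
  { intros t. unfold K, dK.
    apply (is_derive_Rsum (fun i s => Rsum (fun j => c i j / INR (S (n + j)) * s ^ S (n + j)) (S i))).
    intros i _.
    apply (is_derive_Rsum (fun j s => c i j / INR (S (n + j)) * s ^ S (n + j))). intros j _.
    replace (c i j * t ^ (n + j))
      with (INR (S (n + j)) * (c i j / INR (S (n + j))) * t ^ (n + j)).
    - apply is_derive_monomial.
    - field. apply not_0_INR; lia. }
  (* [df] is [exp (- A)] times the real part of the remainder [D] turned by a unimodular factor;
     [|D| <= dK] and [exp (- A) <= exp L]. *)
  assert (Hbound : forall t, 0 <= t <= 1 -> - (exp L * dK t) <= df t).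
  { intros t Ht.
    set (D := (- Csum (fun i => Csum (fun j => g i * e (n - i + j)%nat * t ^ (n + j)) (S i)) n)%C).
    assert (HD : D = (dX t - dA t * X t + dB t * Y t, dY t - dA t * Y t - dB t * X t)).
    { unfold D. rewrite <- truncated_ode by exact He.
      assert (E1 : Csum (fun j => RtoC (INR (S j)) * e (S j) * t ^ j)%C n = (dX t, dY t)).
      { apply C_eq.
        - rewrite Re_Csum. apply Rsum_ext. intros j _. rewrite Re_scal_pow, re_scal_l. reflexivity.
        - rewrite Im_Csum. apply Rsum_ext. intros j _. rewrite Im_scal_pow, im_mult, re_RtoC, im_RtoC.
          ring. }
      assert (E2 : Csum (fun j => g j * t ^ j)%C n = (dA t, dB t)).
      { apply C_eq; [rewrite Re_Csum|rewrite Im_Csum]; apply Rsum_ext; intros j _;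
          [apply Re_scal_pow|apply Im_scal_pow]. }
      assert (E3 : Csum (fun j => e j * t ^ j)%C (S n) = (X t, Y t)).
      { apply C_eq; [rewrite Re_Csum|rewrite Im_Csum]; apply Rsum_ext; intros j _;
          [apply Re_scal_pow|apply Im_scal_pow]. }
      rewrite E1, E2, E3. apply C_eq; simpl; ring. }
    assert (HDm : Cmod D <= dK t).
    { unfold D. rewrite Cmod_opp. eapply Rle_trans; [apply Cmod_Csum_le|].
      apply Rsum_le. intros i _. eapply Rle_trans; [apply Cmod_Csum_le|].
      apply Req_le, Rsum_ext. intros j _.
      rewrite !Cmod_mult, Cmod_pow, Cmod_R, Rabs_pos_eq by lra. reflexivity. }
    assert (Hdf : df t = exp (- A t) * Re (D * Cconj (expi (B t)))%C).
    { unfold df. rewrite HD. simpl. ring. }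
    assert (HR : Rabs (Re (D * Cconj (expi (B t)))%C) <= dK t).
    { eapply Rle_trans; [apply re_le_Cmod|].
      rewrite Cmod_mult, Cmod_conj, Cmod_expi. lra. }
    assert (HAL : exp (- A t) <= exp L).
    { assert (H : - A t <= L).
      { eapply Rle_trans; [|apply (HL n)].
        replace (- A t) with (Rsum (fun i => -1 * (Re (g i) / INR (S i) * t ^ S i)) n)
          by (rewrite Rsum_scal; unfold A; ring).
        apply Rsum_le. intros i _.
        assert (H1 : 0 < / INR (S i)) by (apply Rinv_0_lt_compat, lt_0_INR; lia).
        assert (H2 : 0 <= t ^ S i <= 1).
        { split; [apply pow_le; lra|]. rewrite <- (pow1 (S i)). apply pow_incr; lra. }
        assert (H3 : - Re (g i) <= Cmod (g i)).
        { eapply Rle_trans; [|apply re_le_Cmod]. rewrite <- Rabs_Ropp. apply Rle_abs. }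
        pose proof (Cmod_ge_0 (g i)).
        unfold Rdiv.
        replace (-1 * (Re (g i) * / INR (S i) * t ^ S i))
          with ((- Re (g i) * t ^ S i) * / INR (S i)) by ring.
        apply Rmult_le_compat_r; [lra|]. nra. }
      destruct H as [H|H]; [left; now apply exp_increasing|rewrite H; lra]. }
    pose proof (exp_pos (- A t)).
    apply Rabs_le_between in HR.
    assert (0 <= dK t) by lra.
    rewrite Hdf. nra. }
  (* By [Hbound] the function [f + exp L * K] is nondecreasing; its value at 0 is 1, and [K 1] is
     the defect. *)
  assert (M : f 0 + exp L * K 0 <= f 1 + exp L * K 1).
  { apply (derive_nonneg_le (fun t => f t + exp L * K t) (fun t => df t + exp L * dK t)).
    - intros t. apply (is_derive_plus (V := R_NormedModule) f); [apply Hf|].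
      apply (is_derive_scal K t (exp L)), HK.
    - intros t Ht. specialize (Hbound t Ht). lra. }
  assert (X0 : X 0 = 1).
  { unfold X. rewrite (Rsum_at_0 (fun j => Re (e j))), (proj1 He). reflexivity. }
  assert (A0 : A 0 = 0)
    by (apply (Rsum_S_pow_at_0 (fun i => Re (g i) / INR (S i)))).
  assert (B0 : B 0 = 0)
    by (apply (Rsum_S_pow_at_0 (fun i => Im (g i) / INR (S i)))).
  assert (K0 : K 0 = 0).
  { unfold K. rewrite (Rsum_ext _ (fun _ => 0)); [rewrite Rsum_const; ring|].
    intros i _. rewrite (Rsum_ext _ (fun _ => 0)); [rewrite Rsum_const; ring|].
    intros j _. simpl; ring. }
  assert (K1 : K 1 = ode_defect g e n).
  { apply Rsum_ext; intros i _; apply Rsum_ext; intros j _. rewrite pow1, Rmult_1_r; reflexivity. }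
  assert (f0 : f 0 = 1).
  { unfold f. rewrite X0, A0, B0, Ropp_0, exp_0, cos_0, sin_0. ring. }
  rewrite f0, K0, K1 in M.
  assert (Hdiv : forall (z : C) i, (z / RtoC (INR (S i)))%C = (Re z / INR (S i), Im z / INR (S i))).
  { intros z i. unfold Cdiv. rewrite <- RtoC_inv by (apply not_0_INR; lia). apply C_eq.
    - apply re_scal_r.
    - rewrite im_mult, re_RtoC, im_RtoC. change (Re z * 0 + Im z * / INR (S i) = Im z * / INR (S i)). ring. }
  assert (A1 : Re (Csum (fun i => g i / RtoC (INR (S i)))%C n) = A 1).
  { rewrite Re_Csum. apply Rsum_ext. intros i _. rewrite Hdiv, pow1, Rmult_1_r. reflexivity. }
  assert (B1 : Im (Csum (fun i => g i / RtoC (INR (S i)))%C n) = B 1).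
  { rewrite Im_Csum. apply Rsum_ext. intros i _. rewrite Hdiv, pow1, Rmult_1_r. reflexivity. }
  assert (XY : Csum e (S n) = (X 1, Y 1)).
  { apply C_eq; [rewrite Re_Csum|rewrite Im_Csum]; apply Rsum_ext; intros j _;
      rewrite pow1, Rmult_1_r; reflexivity. }
  rewrite A1, B1, XY.
  replace (Re ((X 1, Y 1) * Cconj (expi (B 1)))%C) with (X 1 * cos (B 1) + Y 1 * sin (B 1))
    by (simpl; ring).
  fold (f 1). lra.
Qed.

(** * Vanishing of the defect for large degree *)

Lemma bounded_sum_tail (c : nat -> R) (D eps : R) : (forall j, 0 <= c j) ->
  (forall J, Rsum c J <= D) -> 0 < eps ->
  exists h, forall m n, (h <= m)%nat -> Rsum (fun j => c (m + j)%nat) n <= eps.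
Proof.
  intros Hc HD Heps.
  destruct (completeness (fun x => exists J, x = Rsum c J)) as [l [Hl1 Hl2]].
  - exists D. intros x [J ->]. apply HD.
  - exists (Rsum c 0), O. reflexivity.
  (* Once a partial sum is within [eps] of the supremum [l], no later block can exceed [eps]. *)
  - assert (H : exists h, l - eps < Rsum c h).
    { apply Classical_Prop.NNPP. intros N.
      assert (l <= l - eps); [|lra].
      apply Hl2. intros x [J ->]. apply Rnot_lt_le. intros H. apply N. now exists J. }
    destruct H as [h Hh]. exists h. intros m n Hm.
    assert (H1 := Rsum_split c m n).
    assert (H2 : Rsum c (m + n) <= l) by (apply Hl1; eexists; reflexivity).
    assert (H3 := Rsum_mono c h m Hc Hm). lra.
Qed.

(** Split at [i = n - h]. Below it, the coefficients of [e] start at [n - i > h] and form a small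
    tail; above it, the weights [|g_i| / (i + 1)] do, since [n >= 2 h] gives [n - h >= h]. *)
Lemma ode_defect_small (g e : nat -> C) (L U eps : R) :
  (forall J, Rsum (fun i => Cmod (g i) / INR (S i)) J <= L) ->
  (forall J, Rsum (fun j => Cmod (e j)) J <= U) -> 0 < eps ->
  exists n0, forall n, (n0 <= n)%nat -> ode_defect g e n <= eps.
Proof.
  intros HL HU Heps.
  assert (L0 : 0 <= L) by apply (HL O). assert (U0 : 0 <= U) by apply (HU O).
  set (d := eps / (L + U + 1)).
  assert (Hd : 0 < d) by (apply Rdiv_lt_0_compat; lra).
  assert (HdE : d * (L + U + 1) = eps) by (unfold d; field; lra).
  assert (Hgp : forall i, 0 <= Cmod (g i) / INR (S i)).
  { intros i. apply Rdiv_le_0_compat; [apply Cmod_ge_0|apply lt_0_INR; lia]. }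
  destruct (bounded_sum_tail (fun i => Cmod (g i) / INR (S i)) L d Hgp HL Hd) as [h1 H1].
  destruct (bounded_sum_tail (fun j => Cmod (e j)) U d (fun j => Cmod_ge_0 _) HU Hd) as [h2 H2].
  set (h := Nat.max h1 h2).
  exists (2 * h)%nat. intros n Hn.
  assert (Hin : forall i, Rsum (fun j => Cmod (g i) * Cmod (e (n - i + j)%nat) / INR (S (n + j))) (S i)
      <= Cmod (g i) / INR (S i) * Rsum (fun j => Cmod (e (n - i + j)%nat)) (S i) \/ (n <= i)%nat).
  { intros i. destruct (Nat.le_gt_cases n i) as [C|C]; [now right|left].
    rewrite <- Rsum_scal. apply Rsum_le. intros j _. unfold Rdiv.
    rewrite Rmult_assoc, (Rmult_comm (Cmod (e _))), <- Rmult_assoc.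
    apply Rmult_le_compat_r; [apply Cmod_ge_0|].
    apply Rmult_le_compat_l; [apply Cmod_ge_0|].
    apply Rinv_le_contravar; [apply lt_0_INR; lia|apply le_INR; lia]. }
  set (F := fun i => Cmod (g i) / INR (S i) * Rsum (fun j => Cmod (e (n - i + j)%nat)) (S i)).
  apply Rle_trans with (Rsum F n).
  { apply Rsum_le. intros i Hi. destruct (Hin i) as [C|C]; [exact C|lia]. }
  assert (E := Rsum_split F (n - h) h). replace (n - h + h)%nat with n in E by lia.
  rewrite E. unfold F.
  apply Rle_trans with (d * L + U * d); [|nra].
  apply Rplus_le_compat.
  - eapply Rle_trans; [|apply Rmult_le_compat_l; [lra|apply (HL (n - h)%nat)]].
    rewrite <- Rsum_scal. apply Rsum_le. intros i Hi. rewrite Rmult_comm.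
    apply Rmult_le_compat_r; [apply Hgp|]. apply H2. lia.
  - eapply Rle_trans; [|apply Rmult_le_compat_l; [exact U0|apply (H1 (n - h)%nat h); lia]].
    rewrite <- Rsum_scal. apply Rsum_le. intros i Hi. rewrite Rmult_comm.
    apply Rmult_le_compat_r; [apply Hgp|].
    set (i' := (n - h + i)%nat).
    assert (S1 := Rsum_split (fun j => Cmod (e j)) (n - i') (S i')).
    assert (0 <= Rsum (fun j => Cmod (e j)) (n - i'))
      by (apply Rsum_nonneg; intros; apply Cmod_ge_0).
    specialize (HU (n - i' + S i')%nat). lra.
Qed.

(** * Roots of the self-inversive polynomial *)

Lemma ex_derive_Rsum (f : nat -> R -> R) (n : nat) (t : R) :
  (forall j, ex_derive (f j) t) -> ex_derive (fun s => Rsum (fun j => f j s) n) t.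
Proof.
  intros H. exists (Rsum (fun j => Derive (f j) t) n).
  apply is_derive_Rsum. intros j _. apply Derive_correct, H.
Qed.

Lemma ex_derive_Re_trig (c : nat -> C) (d : nat -> nat) (n : nat) (t : R) :
  ex_derive (fun s => Re (Csum (fun j => c j * expi s ^ d j)%C n)) t.
Proof.
  apply (ex_derive_ext (fun s => Rsum (fun j =>
    Re (c j) * cos (INR (d j) * s) - Im (c j) * sin (INR (d j) * s)) n)).
  - intros s. rewrite Re_Csum. apply Rsum_ext. intros j _. rewrite expi_pow, re_mult. reflexivity.
  - apply (ex_derive_Rsum (fun j s => Re (c j) * cos (INR (d j) * s) - Im (c j) * sin (INR (d j) * s))).
    intros j. auto_derive. trivial.
Qed.

Lemma ex_derive_Im_trig (c : nat -> C) (d : nat -> nat) (n : nat) (t : R) :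
  ex_derive (fun s => Im (Csum (fun j => c j * expi s ^ d j)%C n)) t.
Proof.
  apply (ex_derive_ext (fun s => Rsum (fun j =>
    Re (c j) * sin (INR (d j) * s) + Im (c j) * cos (INR (d j) * s)) n)).
  - intros s. rewrite Im_Csum. apply Rsum_ext. intros j _. rewrite expi_pow, im_mult. reflexivity.
  - apply (ex_derive_Rsum (fun j s => Re (c j) * sin (INR (d j) * s) + Im (c j) * cos (INR (d j) * s))).
    intros j. auto_derive. trivial.
Qed.

Lemma polar_right_half_plane (w : C) : 0 < Re w ->
  exists rho : R, w = (RtoC rho * expi (atan (Im w / Re w)))%C.
Proof.
  intros Hw. set (al := atan (Im w / Re w)).
  assert (Hc : 0 < cos al) by (pose proof (atan_bound (Im w / Re w)); apply cos_gt_0; unfold al; lra).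
  exists (Re w / cos al). apply C_eq.
  - rewrite re_scal_l. change (Re (expi al)) with (cos al). field. lra.
  - rewrite im_mult, re_RtoC, im_RtoC. change (Im (expi al)) with (sin al).
    assert (T : tan al = Im w / Re w) by apply tan_atan.
    unfold tan in T. replace (Im w) with (Re w * (sin al / cos al)) by (rewrite T; field; lra).
    field. lra.
Qed.

Lemma ex_derive_argument (X Y ph : R -> R) (nu t : R) :
  ex_derive X t -> ex_derive Y t -> ex_derive ph t ->
  X t * cos (ph t) + Y t * sin (ph t) <> 0 ->
  ex_derive (fun s => ph s + atan ((Y s * cos (ph s) - X s * sin (ph s))
                                   / (X s * cos (ph s) + Y s * sin (ph s))) - nu * s) t.
Proof. intros HX HY Hph H0. auto_derive. repeat split; assumption. Qed.

Lemma cos_half_odd_PI (k : nat) : cos ((INR k + / 2) * PI) = 0.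
Proof.
  induction k as [|k IH].
  - simpl. replace ((0 + / 2) * PI) with (PI / 2) by field. apply cos_PI2.
  - rewrite S_INR. replace ((INR k + 1 + / 2) * PI) with ((INR k + / 2) * PI + PI) by ring.
    rewrite neg_cos, IH. ring.
Qed.

(* Coefficients of [s(X) + om X^(2n+1) conj s (1/X)], where [s] is the [n]-th partial sum of [e]. *)
Definition self_inversive (om : C) (e : nat -> C) (n m : nat) : C :=
  if Nat.leb m n then e m
  else if Nat.leb m (2 * n + 1) then (om * Cconj (e (2 * n + 1 - m)%nat))%C
  else 0.

(** The upper [n + 1] coefficients are the lower ones conjugated and reversed, and on the circle
    conjugation inverts [expi t]. *)
Lemma self_inversive_eval (om : C) (e : nat -> C) (n : nat) (t : R) :
  (Csum (fun m => self_inversive om e n m * expi t ^ m) (S (2 * n + 1))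
   = Csum (fun j => e j * expi t ^ j) (S n)
     + om * expi t ^ (2 * n + 1) * Cconj (Csum (fun j => e j * expi t ^ j) (S n)))%C.
Proof.
  replace (S (2 * n + 1)) with (S n + S n)%nat by lia. rewrite Csum_split. f_equal.
  - apply Csum_ext. intros j Hj. unfold self_inversive.
    rewrite (proj2 (Nat.leb_le j n)) by lia. reflexivity.
  - rewrite Csum_conj, <- Csum_scal, <- Csum_rev. apply Csum_ext. intros j Hj.
    unfold self_inversive.
    rewrite (proj2 (Nat.leb_gt _ n)), (proj2 (Nat.leb_le _ (2 * n + 1))) by lia.
    replace (2 * n + 1 - (S n + (S n - 1 - j)))%nat with j by lia.
    replace (S n + (S n - 1 - j))%nat with (2 * n + 1 - j)%nat by lia.
    replace (2 * n + 1)%nat with ((2 * n + 1 - j) + j)%nat at 2 by lia.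
    rewrite Cpow_add_r, Cmult_conj, Cpow_conj.
    transitivity (om * Cconj (e j) * expi t ^ (2 * n + 1 - j)
                  * (expi t ^ j * Cconj (expi t) ^ j))%C.
    + rewrite <- Cpow_mult_l, Cconj_expi, expi_plus, Rplus_opp_r, expi_0, Cpow_1_l. ring.
    + ring.
Qed.

Lemma self_inversive_roots (e b : nat -> C) (n : nat) :
  (forall t, 0 < Re (Csum (fun j => e j * expi t ^ j) (S n)
                     * Cconj (expi (Im (Csum (fun i => b i * expi t ^ S i) n))))%C) ->
  exists (om : C) (th : nat -> R),
    (forall k l, (k < l)%nat -> (l < 2 * n + 1)%nat -> expi (th k) <> expi (th l)) /\
    (forall k, (k < 2 * n + 1)%nat ->
      (Csum (fun m => self_inversive om e n m * expi (th k) ^ m) (S (2 * n + 1)))%C = 0).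
Proof.
  intros Hpos.
  set (s := fun t => Csum (fun j => e j * expi t ^ j)%C (S n)).
  set (ph := fun t => Im (Csum (fun i => b i * expi t ^ S i)%C n)).
  (* [W + i V] is [s] turned by [- ph]. It stays in the right half plane, so [atan (V / W)] is its
     continuous argument. *)
  set (W := fun t => Re (s t) * cos (ph t) + Im (s t) * sin (ph t)).
  set (V := fun t => Im (s t) * cos (ph t) - Re (s t) * sin (ph t)).
  assert (HW : forall t, 0 < W t).
  { intros t. specialize (Hpos t). rewrite re_mult in Hpos.
    unfold W. cbn [Re Im Cconj expi fst snd] in Hpos. unfold s, ph.
    match goal with |- 0 < ?x => match type of Hpos with 0 < ?y =>
      replace x with y by (unfold Re, Im, expi, Cconj; simpl; ring) end end.
    exact Hpos. }
  assert (HWV : forall t, s t = (expi (ph t) * (W t, V t))%C).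
  { intros t. unfold W, V.
    assert (H := sin2_cos2 (ph t)). unfold Rsqr in H.
    apply C_eq; [rewrite re_mult|rewrite im_mult]; cbn [Re Im expi fst snd].
    - transitivity (Re (s t) * (sin (ph t) * sin (ph t) + cos (ph t) * cos (ph t)));
        [rewrite H|]; unfold Re, Im; ring.
    - transitivity (Im (s t) * (sin (ph t) * sin (ph t) + cos (ph t) * cos (ph t)));
        [rewrite H|]; unfold Re, Im; ring. }
  set (nu := INR n + / 2).
  assert (Hnu : INR (2 * n + 1) = 2 * nu).
  { rewrite plus_INR, mult_INR. unfold nu. simpl (INR 1). simpl (INR 2). field. }
  (* A continuous argument of [s t * expi (- nu * t)]. Its first two summands are periodic, so over
     a period it falls by [2 * PI * nu = (2 n + 1) * PI]. *)
  set (be := fun t => ph t + atan (V t / W t) - nu * t).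
  assert (Hbe : continuity be).
  { intros t.
    assert (D1 : ex_derive (fun t => Re (s t)) t) by apply (ex_derive_Re_trig e (fun j => j)).
    assert (D2 : ex_derive (fun t => Im (s t)) t) by apply (ex_derive_Im_trig e (fun j => j)).
    assert (D3 : ex_derive ph t) by apply (ex_derive_Im_trig b S).
    assert (D : ex_derive be t).
    { apply (ex_derive_argument (fun t => Re (s t)) (fun t => Im (s t)) ph nu t D1 D2 D3).
      specialize (HW t). apply Rgt_not_eq, HW. }
    apply continuity_pt_filterlim, (ex_derive_continuous be t D). }
  assert (Hper : be (2 * PI) = be 0 - INR (2 * n + 1) * PI).
  { assert (Hph : ph (2 * PI) = ph 0) by (unfold ph; now rewrite expi_2PI, expi_0).
    assert (Hs : s (2 * PI) = s 0) by (unfold s; now rewrite expi_2PI, expi_0).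
    unfold be, V, W. rewrite Hph, Hs, Hnu. ring. }
  pose proof PI_RGT_0 as Hpi.
  (* The half-odd levels lie strictly between the end values of [be], so each is taken inside
     [(0, 2 PI)], where [expi] is injective. Indices out of range get the dummy value 0. *)
  assert (Hth : forall k, {t | (k < 2 * n + 1)%nat ->
                 0 < t < 2 * PI /\ be t = be 0 - (INR k + / 2) * PI}).
  { intros k. destruct (lt_dec k (2 * n + 1)) as [Hk|Hk]; [|exists 0; tauto].
    assert (Hk' : INR k + 1 <= INR (2 * n + 1)) by (rewrite <- S_INR; apply le_INR; lia).
    pose proof (pos_INR k).
    destruct (IVT_gen be 0 (2 * PI) (be 0 - (INR k + / 2) * PI) Hbe) as [t [Ht E]].
    - rewrite Hper, Rmin_right, Rmax_left by nra. nra.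
    - exists t. intros _. split; [|exact E].
      rewrite Rmin_left, Rmax_right in Ht by lra.
      split; apply Rnot_le_lt; intros H0.
      + replace t with 0 in E by lra. nra.
      + replace t with (2 * PI) in E by lra. rewrite Hper in E. nra. }
  (* With this [om] the polynomial at [expi t] is [2 rho expi (be 0 + nu t) cos (be t - be 0)] for a
     real [rho], and the cosine vanishes at half-odd multiples of [PI]. *)
  exists (expi (2 * be 0)), (fun k => proj1_sig (Hth k)). split.
  - intros k l Hkl Hl E.
    destruct (proj2_sig (Hth k) (ltac:(lia))) as [K1 K2].
    destruct (proj2_sig (Hth l) Hl) as [L1 L2].
    apply expi_inj in E; [|exact K1|exact L1].
    rewrite E, L2 in K2. apply lt_INR in Hkl. nra.
  - intros k Hk. destruct (proj2_sig (Hth k) Hk) as [_ E].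
    set (t := proj1_sig (Hth k)) in *. rewrite self_inversive_eval. fold (s t).
    destruct (polar_right_half_plane (W t, V t) (HW t)) as [rho Hrho].
    change (Im (W t, V t) / Re (W t, V t)) with (V t / W t) in Hrho.
    set (x := be 0 + nu * t). set (y := (INR k + / 2) * PI).
    assert (Hs : s t = (RtoC rho * expi (x - y))%C).
    { rewrite HWV, Hrho.
      replace (x - y) with (ph t + atan (V t / W t)) by (unfold x, y; unfold be in E at 1; lra).
      rewrite <- expi_plus. ring. }
    assert (Hsc : Cconj (s t) = (RtoC rho * expi (y - x))%C).
    { rewrite Hs, Cmult_conj, Cconj_expi, Ropp_minus_distr. f_equal.
      apply C_eq; simpl; ring. }
    rewrite Hsc, Hs, expi_pow.
    replace (INR (2 * n + 1) * t) with (2 * (nu * t)) by (rewrite Hnu; ring).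
    transitivity (RtoC rho * (expi (x - y) + expi (2 * be 0) * expi (2 * (nu * t)) * expi (y - x)))%C;
      [ring|].
    rewrite !expi_plus.
    replace (2 * be 0 + 2 * (nu * t) + (y - x)) with (x + y) by (unfold x; ring).
    unfold Rminus. rewrite <- !expi_plus, <- Cconj_expi.
    transitivity (RtoC rho * expi x * (expi y + Cconj (expi y)))%C; [ring|].
    replace (expi y + Cconj (expi y))%C with (RtoC 0); [ring|].
    apply C_eq; simpl; [|ring]. unfold y. rewrite cos_half_odd_PI. ring.
Qed.

(** * Distinct unimodular numbers with prescribed power sums *)

Lemma unimodular_power_sums (a : nat -> C) (L : R) :
  (forall J, Rsum (fun j => Cmod (a j) / INR (S j)) J <= L) ->
  exists n1, forall n, (n1 <= n)%nat -> exists lam : nat -> C,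
    (forall k, Cmod (lam k) = 1) /\
    (forall k l, (k < l)%nat -> (l < 2 * n + 1)%nat -> lam k <> lam l) /\
    (forall j, (j < n)%nat -> power_sum lam (2 * n + 1) (S j) = a j).
Proof.
  intros HL. set (g := fun j => (- a j)%C).
  assert (HgL : forall J, Rsum (fun j => Cmod (g j) / INR (S j)) J <= L).
  { intros J. eapply Rle_trans; [|apply (HL J)]. apply Req_le, Rsum_ext.
    intros j _. unfold g. now rewrite Cmod_opp. }
  destruct (exp_integral_coefs_exist g) as [e He].
  assert (HU := exp_integral_coefs_summable g e L He HgL).
  (* This tolerance makes the lower bound [1 - exp L * ode_defect g e n] at least [1 / 2]. *)
  destruct (ode_defect_small g e L (exp L) (exp (- L) / 2) HgL HU) as [n1 Hn1].
  { pose proof (exp_pos (- L)). lra. }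
  exists n1. intros n Hn. specialize (Hn1 n Hn).
  set (b := fun i => (g i / RtoC (INR (S i)))%C).
  assert (Hrot : forall t (c : C) j, Cmod (c * expi t ^ j)%C = Cmod c).
  { intros t c j. rewrite Cmod_mult, Cmod_pow, Cmod_expi, pow1. ring. }
  destruct (self_inversive_roots e b n) as [om [th [Hdist Hroot]]].
  (* The estimate at 1 is applied to the coefficients rotated by [expi t]. Rotation preserves all
     moduli, so one threshold serves every [t]. *)
  { intros t.
    assert (Q := taylor_quotient_re _ _ L n (exp_integral_coefs_rotate g e (expi t) He)).
    assert (Q' := Q (fun J => Rle_trans _ _ _
      (Req_le _ _ (Rsum_ext _ _ J (fun j _ => f_equal (fun r => r / INR (S j)) (Hrot t (g j) (S j)))))
      (HgL J))).
    clear Q.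
    replace (ode_defect (fun i => g i * expi t ^ S i)%C (fun j => e j * expi t ^ j)%C n)
      with (ode_defect g e n) in Q'.
    2: { apply Rsum_ext; intros i _; apply Rsum_ext; intros j _. now rewrite !Hrot. }
    rewrite (Csum_ext (fun i => g i * expi t ^ S i / RtoC (INR (S i)))%C
                      (fun i => b i * expi t ^ S i)%C) in Q'.
    2: { intros i _. unfold b. field. apply RtoC_INR_S_neq_0. }
    set (X := Re (_ * _)%C) in *.
    assert (E : exp L * exp (- L) = 1) by (rewrite <- exp_plus, Rplus_opp_r; apply exp_0).
    assert (P1 := exp_pos L).
    set (Y := exp (- Re _)) in Q'. assert (P2 : 0 < Y) by apply exp_pos.
    assert (0 < Y * X) by nra.
    apply Rnot_le_lt. intros HX. nra. }
  assert (Hinv : forall t, (Cconj (expi t) * expi t)%C = 1).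
  { intros t. rewrite Cconj_expi, expi_plus, Rplus_opp_l. apply expi_0. }
  exists (fun k => Cconj (expi (th k))). split; [|split].
  - intros k. rewrite Cmod_conj. apply Cmod_expi.
  - intros k l Hkl Hl E. apply (Hdist k l Hkl Hl).
    rewrite <- (Cconj_conj (expi (th k))), E. apply Cconj_conj.
  - set (lam := fun k => Cconj (expi (th k))).
    assert (N := newton_identities (2 * n + 1) (fun k => expi (th k)) lam (self_inversive om e n)).
    assert (N' := N (fun m Hm => ltac:(unfold self_inversive;
       rewrite (proj2 (Nat.leb_gt m n)), (proj2 (Nat.leb_gt m (2 * n + 1))) by lia; reflexivity))
       (fun k _ => Hinv (th k)) Hdist Hroot).
    clear N. destruct He as [e0 eS].
    (* Up to degree [n] the self-inversive polynomial has the coefficients [e], so Newton's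
       identities and the recurrence [E' = - a E] give the same convolutions for [m < n]. *)
    apply (convolution_unique (fun j => power_sum lam (2 * n + 1) (S j)) a e n e0).
    intros m Hm. specialize (N' m).
    assert (Hse : forall i, (i <= n)%nat -> self_inversive om e n i = e i).
    { intros i Hi. unfold self_inversive. now rewrite (proj2 (Nat.leb_le i n)). }
    rewrite Hse, eS in N' by lia.
    rewrite (Csum_ext (fun i => power_sum lam (2 * n + 1) (S i) * self_inversive om e n (m - i))%C
      (fun i => power_sum lam (2 * n + 1) (S i) * e (m - i)%nat)%C) in N'
      by (intros i Hi; rewrite Hse by lia; reflexivity).
    rewrite (Csum_ext (fun i => g i * e (m - i)%nat)%C (fun i => (-(1)) * (a i * e (m - i)%nat))%C) in N'
      by (intros i Hi; unfold g; ring).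
    rewrite Csum_scal in N'.
    set (S1 := Csum _ _) in N'. set (S2 := Csum _ _) in N' at 1.
    change (Csum (fun i => power_sum lam (2 * n + 1) (S i) * e (m - i)%nat)%C (S m)) with S2.
    fold S1.
    transitivity (S1 + (-(1) * S1 + S2))%C; [ring|]. rewrite N'. ring.
Qed.

(** * The error bound *)

(** The first three binomial terms; the induction step discards the nonnegative cubic term
    [m (m - 1) / 2 * v ^ 3]. *)
Lemma pow_one_plus_ge_quadratic (v : R) (m : nat) : 0 <= v ->
  1 + INR m * v + INR m * (INR m - 1) / 2 * v ^ 2 <= (1 + v) ^ m.
Proof.
  intros Hv. induction m as [|m IH]; [simpl; lra|].
  rewrite S_INR. simpl ((1 + v) ^ S m).
  assert (Hm : 0 <= INR m * (INR m - 1)).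
  { destruct m as [|m]; [simpl; lra|]. rewrite S_INR. pose proof (pos_INR m). nra. }
  assert (0 <= INR m * (INR m - 1) * (v * v ^ 2))
    by (apply Rmult_le_pos; [exact Hm|apply Rmult_le_pos; [exact Hv|apply pow2_ge_0]]).
  assert ((1 + v) * (1 + INR m * v + INR m * (INR m - 1) / 2 * v ^ 2) <= (1 + v) * (1 + v) ^ m)
    by (apply Rmult_le_compat_l; lra).
  nra.
Qed.

(* With [u = 1 - x], keeping only the quadratic term of [(1 + u/4)^(n+1)] in the error bound
   leaves [M n (n+1) x^n / u^2], which beats [M (2 n + 1 + D) x^n / u] for large [n]. *)
Lemma crude_tail_le_err_bound (M D x : R) (n : nat) :
  0 < M -> 0 <= x < 1 -> 0 <= D -> D + 3 <= INR n ->
  M * (INR (2 * n + 1) + D) * x ^ n / (1 - x) <= err_bound M n x.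
Proof.
  intros HM Hx HD Hn. set (u := 1 - x).
  assert (Hu : 0 < u <= 1) by (unfold u; lra).
  assert (P4 : powerRZ 4 (Z.of_nat n - 1) = 4 ^ n / 4).
  { unfold Z.sub. rewrite powerRZ_add, <- pow_powerRZ by lra. simpl. field. }
  assert (Q : INR n * (INR n + 1) / 32 * u ^ 2 <= (1 + u / 4) ^ S n).
  { eapply Rle_trans; [|apply (pow_one_plus_ge_quadratic (u / 4) (S n)); lra].
    rewrite S_INR. pose proof (pos_INR n). nra. }
  unfold err_bound. rewrite P4.
  replace (5 - x) with (4 * (1 + u / 4)) by (unfold u; field).
  replace (3 + x) with (4 - u) by (unfold u; ring). fold u.
  rewrite Rpow_mult_distr.
  replace (x ^ n * (4 ^ S n * (1 + u / 4) ^ S n) / (4 ^ n / 4) * (2 * M / 3) * ((4 - u) / u ^ 4))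
    with (x ^ n * M * ((1 + u / 4) ^ S n * (32 * (4 - u) / (3 * u ^ 4)))).
  2: { simpl (4 ^ S n). field. split; [lra|]. apply pow_nonzero. lra. }
  replace (M * (INR (2 * n + 1) + D) * x ^ n / u)
    with (x ^ n * M * ((INR (2 * n + 1) + D) / u)) by (unfold Rdiv; ring).
  apply Rmult_le_compat_l; [apply Rmult_le_pos; [apply pow_le|]; lra|].
  (* The power is replaced by its quadratic term and [4 - u] by 3, as [u <= 1]; the product is
     [n (n + 1) / u ^ 2]. *)
  apply Rle_trans with (INR n * (INR n + 1) / 32 * u ^ 2 * (32 * 3 / (3 * u ^ 4))).
  - replace (INR n * (INR n + 1) / 32 * u ^ 2 * (32 * 3 / (3 * u ^ 4)))
      with (INR n * (INR n + 1) / u / u) by (field; lra).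
    rewrite plus_INR, mult_INR. simpl (INR 1). simpl (INR 2).
    assert (H1 : (1 + 1) * INR n + 1 + D <= INR n * (INR n + 1)) by nra.
    assert (Hi : 0 < / u) by (apply Rinv_0_lt_compat; lra).
    assert (H2 : INR n * (INR n + 1) <= INR n * (INR n + 1) / u).
    { apply (Rle_div_r _ _ u); [lra|]. assert (0 <= INR n * (INR n + 1) * (1 - u)) by (apply Rmult_le_pos; nra). lra. }
    apply Rmult_le_compat_r; [lra|]. lra.
  - assert (H4 : 0 < u ^ 4) by (apply pow_lt; lra).
    apply Rmult_le_compat.
    + apply Rmult_le_pos; [|apply pow2_ge_0]. pose proof (pos_INR n). nra.
    + apply Rdiv_le_0_compat; lra.
    + exact Q.
    + unfold Rdiv. apply Rmult_le_compat_r; [left; apply Rinv_0_lt_compat; lra|lra].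
Qed.

(** The finite sum over [k] is exchanged with the series: [lam_k h (lam_k z)] contributes
    [h_j lam_k^(j+1)] to the coefficient of [z^j]. The coefficient bounds give convergence of both
    series. *)
Lemma H_N_minus_psum (h a : nat -> C) (lam : nat -> C) (z : C) (N : nat) (M D : R) :
  Cmod z < 1 -> (forall j, Cmod (h j) <= M) -> (forall j, Cmod (a j) <= D) ->
  (forall k, Cmod (lam k) = 1) ->
  Cminus (H_N h N lam z) (psum (fun j => a j * h j)%C z)
  = Cser (fun j => h j * (power_sum lam N (S j) - a j) * z ^ j)%C.
Proof.
  intros Hz HM HD Hlam.
  assert (Hz' : 0 <= Cmod z < 1) by (split; [apply Cmod_ge_0|exact Hz]).
  assert (M0 : 0 <= M) by (eapply Rle_trans; [apply Cmod_ge_0|apply (HM O)]).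
  assert (Eh : forall k, ex_Cser (fun j => h j * (lam k * z) ^ j)%C).
  { intros k. apply (ex_Cser_geom _ M (Cmod z) Hz'). intros j.
    rewrite Cmod_mult, Cmod_pow, Cmod_mult, Hlam, Rmult_1_l.
    apply Rmult_le_compat_r; [apply pow_le, Cmod_ge_0|apply HM]. }
  assert (Ea : ex_Cser (fun j => a j * h j * z ^ j)%C).
  { apply (ex_Cser_geom _ (D * M) (Cmod z) Hz'). intros j.
    rewrite !Cmod_mult, Cmod_pow.
    apply Rmult_le_compat_r; [apply pow_le, Cmod_ge_0|].
    apply Rmult_le_compat; auto using Cmod_ge_0. }
  destruct (Csum_Cser (fun k j => lam k * (h j * (lam k * z) ^ j))%C N) as [E1 E2].
  { intros k _. apply (ex_Cser_scal (lam k)), Eh. }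
  assert (EH : H_N h N lam z = Cser (fun j => Csum (fun k => lam k * (h j * (lam k * z) ^ j)) N)%C).
  { rewrite E2. apply Csum_ext. intros k _. rewrite Cser_scal by apply Eh. reflexivity. }
  rewrite EH. change (psum (fun j => a j * h j)%C z) with (Cser (fun j => a j * h j * z ^ j)%C).
  transitivity (Cser (fun j => Csum (fun k => lam k * (h j * (lam k * z) ^ j)) N)
                + (-(1)) * Cser (fun j => a j * h j * z ^ j))%C; [ring|].
  rewrite <- Cser_scal by exact Ea.
  rewrite <- Cser_plus by (try apply (ex_Cser_scal (-(1))%C); assumption).
  apply Cser_ext. intros j.
  rewrite (Csum_ext _ (fun k => (h j * z ^ j) * lam k ^ S j)%C)
    by (intros k _; rewrite Cpow_mult_l, Cpow_S; ring).
  rewrite Csum_scal. unfold power_sum. ring.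
Qed.

Theorem theorem2p2 (h f : nat -> C) (M : R)
  (h_coef : forall j : nat, 0 < Cmod (h j) <= M)
  (h_analytic : forall z : C, Cmod z < 1 ->
     ex_series (V := C_NormedModule) (fun j => Cmult (h j) (Cpow z j)))
  (F_analytic : forall z : C, Cmod z < 1 ->
     ex_series (V := C_NormedModule)
       (fun j => Cmult (Cdiv (f j) (h j)) (Cpow z j)))
  (F_bounded : exists B : R, forall z : C, Cmod z < 1 ->
     Cmod (psum (fun j => Cdiv (f j) (h j)) z) <= B) :
  exists n1 : nat, forall n : nat, (n1 <= n)%nat ->
    exists lam : nat -> C,
      (forall k : nat, (k < 2 * n + 1)%nat -> Cmod (lam k) = 1) /\
      (forall k l : nat, (k < l)%nat -> (l < 2 * n + 1)%nat -> lam k <> lam l) /\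
      (forall z : C, Cmod z < 1 ->
         Cmod (Cminus (H_N h (2 * n + 1) lam z) (psum f z))
           <= err_bound M n (Cmod z)).
Proof.
  destruct F_bounded as [B HB].
  set (a := fun j => Cdiv (f j) (h j)).
  assert (HB0 : 0 <= B).
  { eapply Rle_trans; [apply Cmod_ge_0|apply (HB 0)]. rewrite Cmod_0; lra. }
  assert (HD := fun J => coef_sq_sum_le a B J F_analytic HB).
  set (D := B + 1) in *. assert (D0 : 0 <= D) by (unfold D; lra).
  assert (HaD := coef_le a D D0 HD).
  assert (HM : 0 < M) by (specialize (h_coef O); lra).
  assert (Hf : forall j, f j = (a j * h j)%C).
  { intros j. unfold a. field. apply Cmod_gt_0, h_coef. }
  destruct (unimodular_power_sums a _ (hardy_sum_le a _ HD)) as [n1 H1].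
  destruct (INR_unbounded (D + 3)) as [n2 H2].
  (* [n1] secures the power sums, and [n2] secures [D + 3 <= n] for the final estimate. *)
  exists (Nat.max n1 n2). intros n Hn.
  destruct (H1 n (ltac:(lia))) as [lam [Hlam [Hdist Hps]]].
  exists lam. split; [auto|]. split; [exact Hdist|].
  intros z Hz.
  replace (psum f z) with (psum (fun j => a j * h j)%C z)
    by (apply Cser_ext; intros j; now rewrite Hf).
  rewrite (H_N_minus_psum h a lam z (2 * n + 1) M D Hz (fun j => proj2 (h_coef j)) HaD Hlam).
  assert (Hz' : 0 <= Cmod z < 1) by (split; [apply Cmod_ge_0|exact Hz]).
  eapply Rle_trans; [|apply (crude_tail_le_err_bound M D (Cmod z) n HM Hz' D0)].
  2: { assert (INR n2 <= INR n) by (apply le_INR; lia). lra. }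
  set (b := fun j => (h j * (power_sum lam (2 * n + 1) (S j) - a j) * z ^ j)%C).
  (* The first [n] terms of [b] vanish by the choice of [lam], so this tail is the whole error. Its
     coefficients are at most [M * (2 n + 1 + D)], as the [lam k] are unimodular. *)
  assert (T : Cmod (Cser b - Csum b n)%C
              <= M * (INR (2 * n + 1) + D) * Cmod z ^ n / (1 - Cmod z)).
  { apply Cser_tail_le; [exact Hz'|]. intros j. unfold b.
    rewrite !Cmod_mult, Cmod_pow.
    apply Rmult_le_compat_r; [apply pow_le, Cmod_ge_0|].
    apply Rmult_le_compat; [apply Cmod_ge_0|apply Cmod_ge_0|apply h_coef|].
    eapply Rle_trans; [apply Cmod_triangle|]. rewrite Cmod_opp.
    apply Rplus_le_compat; [|apply HaD].
    eapply Rle_trans; [apply Cmod_Csum_le|].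
    rewrite (Rsum_ext _ (fun _ => 1)) by (intros; rewrite Cmod_pow, Hlam; apply pow1).
    rewrite Rsum_const. lra. }
  replace (Csum b n) with (RtoC 0) in T.
  - replace (Cser b - 0)%C with (Cser b) in T by ring. exact T.
  - rewrite (Csum_ext b (fun _ => RtoC 0)); [now rewrite Csum_zero|].
    intros j Hj. unfold b. rewrite Hps by exact Hj. ring.
Qed.
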